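(* Let $C\in B_2(L)$. For every complete orthonormal system $\{e_j\}_{j\in\mathbb N}$ in $L$ the partial sums $\Delta^+_M(C):=\sum_{j=1}^M a^\dagger(Ce_j)a^\dagger(\bar e_j)$ converge strongly on $D_1$ to an operator $\Delta^+(C)$ that does not depend on the choice of the complete orthonormal system, and \[ \|\Delta^+(C)\Phi\|^2\le\|C\|^2\,\|(N(N+2\,\mathrm{id}))^{1/2}\Phi\|^2+\|C\|_2^2\,\|(N+2\,\mathrm{id})^{1/2}\Phi\|^2,\qquad\Phi\in D_1 . \] Furthermore, $\Delta^+(C^T)=\Delta^+(C)$, and if $C^T=C$ then $\Delta^+(C)=\Delta(C^* )^*$ on $D_1$, i.e. $(\Phi,\Delta^+(C)\Psi)=(\Delta(C^* )\Phi,\Psi)$ for all $\Phi,\Psi\in D_1$, where $\Delta(C^* )$ is the strong limit on $D_1$ of $\sum_{j=1}^M a(C^*e_j)a(\bar e_j)$.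
   Context: $L$ is a separable complex Hilbert space with $\dim L=\infty$, scalar product antilinear in the first argument, and a conjugation $J:f\mapsto\bar f$ (antilinear involution with $(\bar f,\bar g)=(g,f)$); for bounded $C$, $\bar C:=JCJ$ and $C^T:=(\bar C)^*$. $B_2(L)$ denotes the Hilbert–Schmidt operators on $L$, $\|C\|$ the operator norm, $\|C\|_2$ the Hilbert–Schmidt norm. $\mathcal F$ carries a Fock representation of the CCR over $L$: on a dense invariant domain $D$ there are operators $a(f),a^\dagger(f)$, linear in $f$, with $[a(f),a(g)]=0=[a^\dagger(f),a^\dagger(g)]$, $[a(f),a^\dagger(g)]=(\bar f,g)\mathrm{id}$, $(a(f)\Phi,\Psi)=(\Phi,a^\dagger(\bar f)\Psi)$, a unit vacuum $\Omega$ with $a(f)\Omega=0$, and $\mathcal F$ is the closure of the span of all vectors $a^\dagger(f_n)\cdots a^\dagger(f_1)\Omega$. $\mathcal F^{(n)}$ is the closure of the span of such vectors with exactly $n$ creation operators; $\mathcal F=\bigoplus_n\mathcal F^{(n)}$, $\Phi^{(n)}$ the component in $\mathcal F^{(n)}$. $D_\alpha:=\{\Phi:\sum_n(n+1)^{2\alpha}\|\Phi^{(n)}\|^2<\infty\}$. The operators $a(f),a^\dagger(f)$ extend to $D_{1/2}$ (changing particle number by $\mp1$); these extensions are used. $N$ is the number operator, $(N\Phi)^{(n)}=n\Phi^{(n)}$; $(N(N+2\mathrm{id}))^{1/2}$ and $(N+2\mathrm{id})^{1/2}$ act on $\mathcal F^{(n)}$ as multiplication by $\sqrt{n(n+2)}$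 and $\sqrt{n+2}$. *)

(* Defs.v *)
(* MathComp-Analysis over an abstract R : realType,
   complex numbers R[i] from mathcomp-real-closed.
   Abstract setting of the paper: a separable infinite-dimensional complex
   Hilbert space L with a conjugation J, and a Fock representation of the CCR
   over L on a Hilbert space F (given abstractly, as in the paper's context). *)
From Stdlib Require Import ClassicalEpsilon.
From mathcomp Require Import all_boot all_order all_algebra.
From mathcomp Require Import all_classical all_reals all_analysis.
From mathcomp Require Import complex.
Set Implicit Arguments. Unset Strict Implicit. Unset Printing Implicit Defensive.
Import Order.TTheory GRing.Theory Num.Theory numFieldNormedType.Exports.
Local Open Scope classical_set_scope.
Local Open Scope ring_scope.

(* Complex Hilbert spaces (scalar product antilinear in the first argument) *)
Section Hilbert.
Context {R : realType} {V : lmodType R[i]} (ip : V -> V -> R[i]).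

Definition inner_product : Prop :=
  [/\ (forall x y z, ip x (y + z) = ip x y + ip x z),
      (forall (c : R[i]) x y, ip x (c *: y) = c * ip x y),
      (forall x y, ip y x = (ip x y)^*),
      (forall x, 0 <= ip x x) &
      (forall x, ip x x = 0 -> x = 0)].

(* the norm ||x|| = (x,x)^(1/2), as a real number *)
Definition hnorm (x : V) : R := Num.sqrt (complex.Re (ip x x)).

(* norm convergence of a sequence *)
Definition hcvg (u : nat -> V) (x : V) : Prop :=
  (fun n => hnorm (u n - x)) @ \oo --> (0 : R).

Definition hcauchy (u : nat -> V) : Prop :=
  forall eps : R, 0 < eps -> exists N : nat,
    forall m n, (N <= m)%N -> (N <= n)%N -> hnorm (u m - u n) < eps.

Definition hilbert : Prop :=
  inner_product /\ (forall u, hcauchy u -> exists x, hcvg u x).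

(* finite linear combinations and norm closure *)
Definition hspan (S : set V) : set V :=
  [set x | exists (n : nat) (c : 'I_n -> R[i]) (v : 'I_n -> V),
      (forall i, S (v i)) /\ x = \sum_(i < n) c i *: v i].

Definition hclosure (S : set V) : set V :=
  [set x | forall eps : R, 0 < eps -> exists y, S y /\ hnorm (x - y) < eps].

Definition separable : Prop :=
  exists d : nat -> V, hclosure (range d) = setT.

Definition orthonormal (e : nat -> V) : Prop :=
  forall i j, ip (e i) (e j) = (i == j)%:R.

(* dim = infinity *)
Definition infinite_dim : Prop := exists e : nat -> V, orthonormal e.

(* complete orthonormal system indexed by nat *)
Definition cons_ (e : nat -> V) : Prop :=
  orthonormal e /\ (forall x, (forall j, ip (e j) x = 0) -> x = 0).

(* conjugation: antilinear involution with (Jf, Jg) = (g, f) *)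
Definition conjugation (J : V -> V) : Prop :=
  [/\ (forall x y, J (x + y) = J x + J y),
      (forall (c : R[i]) x, J (c *: x) = c^* *: J x),
      (forall x, J (J x) = x) &
      (forall x y, ip (J x) (J y) = ip y x)].

(* bounded (linear) operators, operator norm, adjoint, C-bar, transpose *)
Definition bounded_op (A : V -> V) : Prop :=
  (forall (c : R[i]) x y, A (c *: x + y) = c *: A x + A y) /\
  exists M : R, forall x, hnorm (A x) <= M * hnorm x.

Definition opnorm (A : V -> V) : R :=
  sup [set hnorm (A x) | x in [set x | hnorm x <= 1]].

Definition adjoint (A : V -> V) : V -> V :=
  epsilon (inhabits A) (fun B => forall x y, ip (A x) y = ip x (B y)).

Definition cbar (J : V -> V) (A : V -> V) : V -> V := fun x => J (A (J x)).

Definition transp (J : V -> V) (A : V -> V) : V -> V := adjoint (cbar J A).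

(* Hilbert-Schmidt operators and the Hilbert-Schmidt norm
   ||A||_2^2 = sum_j ||A e_j||^2 for a complete orthonormal system (e_j) *)
Definition hs_series (A : V -> V) (e : nat -> V) (s : R) : Prop :=
  (fun M => \sum_(j < M) hnorm (A (e j)) ^+ 2) @ \oo --> s.

Definition hilbert_schmidt (A : V -> V) : Prop :=
  bounded_op A /\ exists e s, cons_ e /\ hs_series A e s.

Definition hs_norm (A : V -> V) : R :=
  Num.sqrt (sup [set s | exists e, cons_ e /\ hs_series A e s]).

End Hilbert.

(* Fock representation of the CCR over L                                     *)
Section Fock.
Context {R : realType} {L F : lmodType R[i]}.
Variables (ipL : L -> L -> R[i]) (J : L -> L) (ipF : F -> F -> R[i]).
Variables (a ad : L -> F -> F) (D : set F) (Om : F).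

(* a^+(f_n) ... a^+(f_1) Omega *)
Definition cvec (fs : seq L) : F := foldr (fun f P => ad f P) Om fs.

Definition all_cvecs : set F := [set cvec fs | fs in [set: seq L]].
Definition n_cvecs (n : nat) : set F :=
  [set cvec fs | fs in [set fs : seq L | size fs = n]].

Definition fock_rep : Prop :=
  [/\ (* D is a dense linear subspace *)
      [/\ D 0, (forall P Q, D P -> D Q -> D (P + Q)),
          (forall (c : R[i]) P, D P -> D (c *: P)) & hclosure ipF D = setT],
      (* D is invariant, the operators are linear, and linear in f *)
      [/\ (forall f P, D P -> D (a f P)), (forall f P, D P -> D (ad f P)),
          (forall f (c : R[i]) P Q, D P -> D Q ->
              a f (c *: P + Q) = c *: a f P + a f Q /\
              ad f (c *: P + Q) = c *: ad f P + ad f Q) &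
          (forall f g (c : R[i]) P, D P ->
              a (c *: f + g) P = c *: a f P + a g P /\
              ad (c *: f + g) P = c *: ad f P + ad g P)],
      (* canonical commutation relations on D *)
      (forall f g P, D P ->
         [/\ a f (a g P) = a g (a f P), ad f (ad g P) = ad g (ad f P) &
             a f (ad g P) - ad g (a f P) = ipL (J f) g *: P]),
      (* (a(f) Phi, Psi) = (Phi, a^+(bar f) Psi) *)
      (forall f P Q, D P -> D Q -> ipF (a f P) Q = ipF P (ad (J f) Q)) &
      (* unit vacuum annihilated by all a(f); F is the closure of the span
         of the creation vectors *)
      [/\ D Om, ipF Om Om = 1, (forall f, a f Om = 0) &
          hclosure ipF (hspan all_cvecs) = setT]].

(* F^(n) and the component Phi^(n) (orthogonal projection onto F^(n)) *)
Definition Fn (n : nat) : set F := hclosure ipF (hspan (n_cvecs n)).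

Definition comp (n : nat) (P : F) : F :=
  epsilon (inhabits 0)
    (fun y => Fn n y /\ forall z, Fn n z -> ipF z (P - y) = 0).

(* sum_n w(n) ||Phi^(n)||^2 in the extended reals *)
Definition wsum (w : nat -> R) (P : F) : \bar R :=
  (\sum_(n <oo) ((w n) * hnorm ipF (comp n P) ^+ 2)%:E)%E.

(* D_alpha *)
Definition Dalpha (alpha : R) : set F :=
  [set P | (wsum (fun n => ((n.+1)%:R `^ (2 * alpha))%R) P < +oo)%E].

(* the operator acting on F^(n) as multiplication by w(n) *)
Definition mulop (w : nat -> R) (P : F) : F :=
  epsilon (inhabits 0)
    (fun z => hcvg ipF (fun M => \sum_(n < M) ((w n)%:C)%C *: comp n P) z).

(* the extension to D_{1/2} of an operator A defined on finite particle
   vectors: closure with respect to the norm of D_{1/2} *)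
Definition ext_rel (A : F -> F) (P z : F) : Prop :=
  exists Pk : nat -> F, [/\ (forall k, hspan all_cvecs (Pk k)),
     (fun k => wsum (fun n => (n.+1)%:R) (Pk k - P)) @ \oo --> 0%E &
     hcvg ipF (fun k => A (Pk k)) z].

Definition ext (A : F -> F) (P : F) : F := epsilon (inhabits 0) (ext_rel A P).

Definition a_ext (f : L) : F -> F := ext (a f).
Definition ad_ext (f : L) : F -> F := ext (ad f).

(* Delta^+_M(C) Phi = sum_{j=1}^M a^+(C e_j) a^+(bar e_j) Phi,
   Delta_M(C) Phi = sum_{j=1}^M a(C e_j) a(bar e_j) Phi
   (the system e is indexed from 0) *)
Definition DeltaplusM (C : L -> L) (e : nat -> L) (M : nat) (P : F) : F :=
  \sum_(j < M) ad_ext (C (e j)) (ad_ext (J (e j)) P).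
Definition DeltaM (C : L -> L) (e : nat -> L) (M : nat) (P : F) : F :=
  \sum_(j < M) a_ext (C (e j)) (a_ext (J (e j)) P).

(* the strong limits (the same limit for every complete orthonormal system) *)
Definition Deltaplus (C : L -> L) (P : F) : F :=
  epsilon (inhabits 0) (fun z => forall e, cons_ ipL e ->
                                   hcvg ipF (fun M => DeltaplusM C e M P) z).
Definition Delta (C : L -> L) (P : F) : F :=
  epsilon (inhabits 0) (fun z => forall e, cons_ ipL e ->
                                   hcvg ipF (fun M => DeltaM C e M P) z).

End Fock.

(* Main.v *)
(* Everything is tested weakly against the span S of the creation vectors:
   (Psi, a^+(f) P) = (a(Jf) Psi, P), so (Psi, Delta^+_M(C) P) = (B_M Psi, P) with
   B_M Psi = sum_{j<M} a(e_j) a(J C e_j) Psi. On n+2 particles,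
     ||B_M Psi||^2 <= (c n + s) (n+2) ||Psi||^2,   s = sum_{j<M} ||C e_j||^2,
   where c is a Bessel constant of the family (C e_j)_{j<M}: pair B_M Psi with itself,
   move a(J C e_j) to the other side and use
     sum_j ||a(J g_j) Phi||^2 <= c n ||Phi||^2   (second quantization of sum_j |g_j><g_j|)
   for g_j = C e_j and for g_j = J e_j. With c = ||C||^2 this is the bound of the theorem.
   With c = s, applied to the tail K <= j < M, it shows that Delta^+_M(C) P is Cauchy.
   On creation vectors B_M converges to an expression that involves only C and its
   adjoint and is symmetric under C -> C^T, so the limit depends neither on the
   system (e_j) nor on whether C or C^T is used. For C^T = C, the formal adjoint of
   Delta_M(C^* ) for (e_j) is Delta^+_M(C) for (J e_j), which gives the last claim. *)
Require Import Defs.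
From Stdlib Require Import ClassicalEpsilon.
From mathcomp Require Import all_boot all_order all_algebra.
From mathcomp Require Import all_classical all_reals all_analysis.
From mathcomp Require Import complex.
From mathcomp Require Import ring lra.
Import Order.TTheory GRing.Theory Num.Theory numFieldNormedType.Exports.
Local Open Scope classical_set_scope.
Local Open Scope ring_scope.

Set Implicit Arguments.
Unset Strict Implicit.
Unset Printing Implicit Defensive.

(** * Inner product spaces *)

(** [comp], [adjoint], [ext], [mulop], [Deltaplus] and [Delta] are choices by [epsilon], so each is
    known only through a property that determines its value. For the extended operators and their
    limits this property is the pairing with the dense span [S]. A vector z with (Psi, z) = (T Psi,
    P), where T shifts the particle number, inherits the bounds of T sector by sector; hence only
    estimates for finite sums of products on creation vectors have to be computed, and they carry
    over to D_1.

    Origin of the factor (c n + s) (n+2): X = B_M Psi has n particles, and the commutation relations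
    split the sum of the |a^+(g_j) X|^2 into the sum of the |a(J g_j) X|^2, at most c n |X|^2, and s
    |X|^2. The factor n+2 is the estimate with c = 1 for the orthonormal family acting on Psi.

    On tails c has to tend to zero together with s. The operator norm does not give this, which is
    why the Cauchy argument takes c = s.

    Delta lowers the particle number, so its bound is obtained by dualizing once more: from B_M to
    Delta^+_M on a sector, and from there to Delta_M. *)

Local Notation normc := Normc.normc.
Local Notation orthonormal := Defs.orthonormal.

Section Modulus.
Context {R : realType}.
Implicit Types (z w : R[i]) (x y : R).

Lemma normcE_norm z : (normc z)%:C%C = `|z|.
Proof. by []. Qed.

Lemma normc_ge0 z : 0 <= normc z.
Proof. by rewrite -ler0c normcE_norm. Qed.

Lemma sqr_normcE z : ((normc z) ^+ 2)%:C%C = z * z^*.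
Proof. by rewrite rmorphXn /= normcE_norm normCK. Qed.

Lemma normcJ z : normc z^* = normc z.
Proof. by apply: complexI; rewrite normcE_norm norm_conjC. Qed.

Lemma normc_real x : normc x%:C%C = `|x|.
Proof. by rewrite /= expr0n addr0 sqrtr_sqr. Qed.

Lemma conj_realc x : (x%:C%C)^* = x%:C%C :> R[i].
Proof. by apply: CrealP; rewrite complex_real. Qed.

Lemma realcM x y : (x * y)%:C%C = x%:C%C * y%:C%C :> R[i].
Proof. exact: (rmorphM (real_complex R)). Qed.

Lemma realcD x y : (x + y)%:C%C = x%:C%C + y%:C%C :> R[i].
Proof. exact: (rmorphD (real_complex R)). Qed.

Lemma realcB x y : (x - y)%:C%C = x%:C%C - y%:C%C :> R[i].
Proof. exact: (rmorphB (real_complex R)). Qed.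

Lemma realc_nat n : (n%:R)%:C%C = n%:R :> R[i].
Proof. exact: (rmorph_nat (real_complex R)). Qed.

Lemma realc_sum (I : Type) (r : seq I) (P : pred I) (f : I -> R) :
  (\sum_(i <- r | P i) f i)%:C%C = \sum_(i <- r | P i) (f i)%:C%C :> R[i].
Proof. exact: (rmorph_sum (real_complex R)). Qed.

Lemma Re_le_normc z : complex.Re z <= normc z.
Proof.
apply: le_trans (ler_norm _) _; rewrite -lecR normcE_norm; exact: normc_ge_Re.
Qed.

Lemma normc_eq_eps z w : (forall eps, 0 < eps -> normc (z - w) <= eps) -> z = w.
Proof.
move=> h; apply/eqP; rewrite -subr_eq0; apply/eqP/Normc.eq0_normc.
by apply/eqP; rewrite eq_le normc_ge0 andbT; apply/ler_addgt0Pl => e /h; rewrite addr0.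
Qed.

Lemma normc_sum n (f : nat -> R[i]) :
  normc (\sum_(j < n) f j) <= \sum_(j < n) normc (f j).
Proof.
elim: n => [|n IH]; first by rewrite !big_ord0 Normc.normc0.
rewrite !big_ord_recr /=; apply: le_trans (le_normcD _ _) _.
by rewrite lerD2r.
Qed.

End Modulus.

(** Cancels one factor after a vector has been paired with itself. *)
Lemma sqr_le_mul_le {R : realType} (x y : R) : 0 <= y -> 0 <= x ->
  x ^+ 2 <= y * x -> x <= y.
Proof.
move=> y0; rewrite le_eqVlt => /orP[/eqP <- //|x0].
by rewrite expr2 ler_pM2r.
Qed.

Section InnerProduct.
Context {R : realType} {V : lmodType R[i]} {ip : V -> V -> R[i]}.
Hypothesis hip : inner_product ip.
Local Notation hn := (hnorm ip).
Local Notation hcvg := (hcvg ip).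

Lemma ipDr x y z : ip x (y + z) = ip x y + ip x z.
Proof. by case: hip. Qed.

Lemma ipZr c x y : ip x (c *: y) = c * ip x y.
Proof. by case: hip. Qed.

Lemma ipC x y : ip y x = (ip x y)^*.
Proof. by case: hip. Qed.

Lemma ipDl x y z : ip (y + z) x = ip y x + ip z x.
Proof. by rewrite ipC ipDr rmorphD /= -!ipC. Qed.

Lemma ipZl c x y : ip (c *: y) x = c^* * ip y x.
Proof. by rewrite ipC ipZr rmorphM /= -ipC. Qed.

Lemma ip0r x : ip x 0 = 0.
Proof. by rewrite -(scale0r 0) ipZr mul0r. Qed.

Lemma ip0l x : ip 0 x = 0.
Proof. by rewrite ipC ip0r conjC0. Qed.

Lemma ipNr x y : ip x (- y) = - ip x y.
Proof. by rewrite -scaleN1r ipZr mulN1r. Qed.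

Lemma ipNl x y : ip (- y) x = - ip y x.
Proof. by rewrite ipC ipNr rmorphN /= -ipC. Qed.

Lemma ipBr x y z : ip x (y - z) = ip x y - ip x z.
Proof. by rewrite ipDr ipNr. Qed.

Lemma ipBl x y z : ip (y - z) x = ip y x - ip z x.
Proof. by rewrite ipDl ipNl. Qed.

Lemma ip_sumr x (I : Type) (r : seq I) (P : pred I) (f : I -> V) :
  ip x (\sum_(i <- r | P i) f i) = \sum_(i <- r | P i) ip x (f i).
Proof. exact: (big_morph _ (ipDr x) (ip0r x)). Qed.

Lemma ip_suml x (I : Type) (r : seq I) (P : pred I) (f : I -> V) :
  ip (\sum_(i <- r | P i) f i) x = \sum_(i <- r | P i) ip (f i) x.
Proof. exact: (big_morph (ip^~ x) (ipDl x) (ip0l x)). Qed.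

Lemma hn_ge0 x : 0 <= hn x.
Proof. exact: sqrtr_ge0. Qed.

Lemma hn2E x : (hn x ^+ 2)%:C%C = ip x x.
Proof.
have h : 0 <= ip x x by case: hip.
have h2 := RRe_real (ger0_real h).
by rewrite /hnorm sqr_sqrtr ?h2 // -ler0c h2.
Qed.

Lemma hn2_eq x y : ip x x = ip y y -> hn x = hn y.
Proof. by rewrite /hnorm => ->. Qed.

Lemma hn0 : hn 0 = 0.
Proof. by rewrite /hnorm ip0r sqrtr0. Qed.

Lemma hn0_eq x : hn x = 0 -> x = 0.
Proof.
move=> h; case: hip => _ _ _ _; apply.
by rewrite -hn2E h expr0n.
Qed.

Lemma hnZ c x : hn (c *: x) = normc c * hn x.
Proof.
apply/eqP; rewrite -(@eqrXn2 _ 2) // ?hn_ge0 ?mulr_ge0 ?normc_ge0 ?hn_ge0 //.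
apply/eqP/complexI; rewrite hn2E ipZr ipZl exprMn rmorphM /= hn2E sqr_normcE.
by rewrite mulrA.
Qed.

Lemma hnN x : hn (- x) = hn x.
Proof. by apply: hn2_eq; rewrite ipNr ipNl opprK. Qed.

Lemma hnBC x y : hn (x - y) = hn (y - x).
Proof. by rewrite -hnN opprB. Qed.

Lemma cauchy_schwarz x y : normc (ip x y) <= hn x * hn y.
Proof.
have [y0|y0] := eqVneq (hn y) 0.
  by rewrite (hn0_eq y0) ip0r Normc.normc0 hn0 mulr0.
(* The part of [x] orthogonal to [y], multiplied by [|y|^2] to avoid a division. *)
pose w := (hn y ^+ 2)%:C%C *: x - ip y x *: y.
have E : hn w ^+ 2 = hn y ^+ 2 * (hn x ^+ 2 * hn y ^+ 2 - normc (ip x y) ^+ 2).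
  apply: complexI; rewrite hn2E /w ipBr !ipBl !ipZr !ipZl conj_realc.
  rewrite [in RHS]realcM realcB realcM !hn2E sqr_normcE -(ipC x y) -?(ipC y x).
  ring.
have h := sqr_ge0 (hn w).
rewrite E pmulr_rge0 ?subr_ge0 in h; last by rewrite exprn_even_gt0.
by rewrite -(@ler_pXn2r _ 2) ?nnegrE ?mulr_ge0 ?normc_ge0 ?hn_ge0 // exprMn.
Qed.

Lemma hn2D x y : hn (x + y) ^+ 2 = hn x ^+ 2 + hn y ^+ 2 + 2 * complex.Re (ip x y).
Proof.
apply: complexI; rewrite hn2E !realcD !hn2E ipDr !ipDl realcM (ReJ_add (ip x y)).
rewrite -[((ip x y)^*)%C]/((ip x y)^*) -ipC realc_nat; by field.
Qed.

Lemma hnD x y : hn (x + y) <= hn x + hn y.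
Proof.
rewrite -(@ler_pXn2r _ 2) ?nnegrE ?addr_ge0 ?hn_ge0 // hn2D.
have := le_trans (Re_le_normc _) (cauchy_schwarz x y); nra.
Qed.

Lemma hnD_dist x y z : hn (x - z) <= hn (x - y) + hn (y - z).
Proof. by rewrite -[x in hn (x - z)](subrK y) -addrA hnD. Qed.

Lemma hn2_orth x y : ip x y = 0 -> hn (x + y) ^+ 2 = hn x ^+ 2 + hn y ^+ 2.
Proof. by move=> h; rewrite hn2D h mulr0 addr0. Qed.

Lemma hn2_sum_orth n (f : nat -> V) : (forall i j, (i < n)%N -> (j < n)%N -> i != j -> ip (f i) (f j) = 0) ->
  hn (\sum_(j < n) f j) ^+ 2 = \sum_(j < n) hn (f j) ^+ 2.
Proof.
elim: n => [|n IH] h; first by rewrite !big_ord0 hn0 expr0n.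
rewrite !big_ord_recr /= hn2_orth ?IH // => [i j ? ?|].
  by apply: h; rewrite ltnS ltnW.
rewrite ip_suml big1 // => -[i ilt] _; apply: h => //=; first exact: ltnW.
by rewrite neq_ltn ilt.
Qed.

Lemma hcvgP u x : hcvg u x <->
  forall eps, 0 < eps -> exists N, forall n, (N <= n)%N -> hn (u n - x) < eps.
Proof.
split=> [/cvgrPdist_lt h eps /h [N _ hN]|h].
  exists N => n /hN; by rewrite /= sub0r normrN ger0_norm ?hn_ge0.
apply/cvgrPdist_lt => eps /h [N hN]; exists N => // n /hN.
by rewrite /= sub0r normrN ger0_norm ?hn_ge0.
Qed.

Lemma hcvg_cst x : hcvg (fun=> x) x.
Proof. by apply/hcvgP => e e0; exists 0%N => n _; rewrite subrr hn0. Qed.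

Lemma hcvg_ext u v x : (forall n, u n = v n) -> hcvg u x -> hcvg v x.
Proof. by move=> /funext ->. Qed.

Lemma hcvgD u v x y : hcvg u x -> hcvg v y -> hcvg (fun n => u n + v n) (x + y).
Proof.
move=> /hcvgP h /hcvgP k; apply/hcvgP => e e0.
have e2 : 0 < e / 2 by rewrite divr_gt0.
have [N1 h1] := h _ e2; have [N2 h2] := k _ e2.
exists (maxn N1 N2) => n; rewrite geq_max => /andP[/h1 a /h2 b].
rewrite opprD addrACA; apply: le_lt_trans (hnD _ _) _; lra.
Qed.

Lemma hcvgZ c u x : hcvg u x -> hcvg (fun n => c *: u n) (c *: x).
Proof.
move=> /hcvgP h; apply/hcvgP => e e0.
have c0 := normc_ge0 c.
have e2 : 0 < e / (normc c + 1) by rewrite divr_gt0 // ltr_wpDl.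
have [N hN] := h _ e2; exists N => n /hN.
rewrite ltr_pdivlMr ?ltr_wpDl // -scalerBr hnZ; have := hn_ge0 (u n - x); nra.
Qed.

Lemma hcvgB u v x y : hcvg u x -> hcvg v y -> hcvg (fun n => u n - v n) (x - y).
Proof.
move=> h /(hcvgZ (-1)) k; have := hcvgD h k; rewrite scaleN1r; apply: hcvg_ext => n.
by rewrite scaleN1r.
Qed.

Lemma hcvg_unique u x y : hcvg u x -> hcvg u y -> x = y.
Proof.
move=> /hcvgP h /hcvgP k; apply/eqP; rewrite -subr_eq0; apply/eqP/hn0_eq/eqP.
rewrite eq_le hn_ge0 andbT; apply/ler_addgt0Pl => e e0; rewrite addr0.
have e2 : 0 < e / 2 by rewrite divr_gt0.
have [N1 h1] := h _ e2; have [N2 h2] := k _ e2.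
have := h1 (maxn N1 N2) (leq_maxl _ _); have := h2 (maxn N1 N2) (leq_maxr _ _).
rewrite (hnBC _ x) => a b; have := hnD_dist x (u (maxn N1 N2)) y; lra.
Qed.

Lemma hcvg_hn_le u x (B : R) : hcvg u x -> (exists N, forall n, (N <= n)%N -> hn (u n) <= B) ->
  hn x <= B.
Proof.
move=> /hcvgP h [N hN]; apply/ler_addgt0Pl => e /h [N1 h1].
have := h1 (maxn N N1) (leq_maxr _ _); have := hN (maxn N N1) (leq_maxl _ _).
rewrite hnBC; have := hnD (x - u (maxn N N1)) (u (maxn N N1)); rewrite subrK; lra.
Qed.

Lemma hcvg_bounded u x : hcvg u x -> exists N B, 0 <= B /\ forall n, (N <= n)%N -> hn (u n) <= B.
Proof.
move=> /hcvgP /(_ 1 ltr01) [N hN]; exists N, (hn x + 1); split=> [|n /hN].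
  by rewrite addr_ge0 ?hn_ge0.
have := hnD (u n - x) x; rewrite subrK; lra.
Qed.

Lemma hcvg_cauchy u x : hcvg u x -> hcauchy ip u.
Proof.
move=> /hcvgP h e e0; have e2 : 0 < e / 2 by rewrite divr_gt0.
have [N hN] := h _ e2; exists N => m n /hN a /hN; rewrite hnBC => b.
have := hnD_dist (u m) x (u n); lra.
Qed.

Lemma hcvg_ip u v x y : hcvg u x -> hcvg v y -> forall eps, 0 < eps ->
  exists N, forall n, (N <= n)%N -> normc (ip (u n) (v n) - ip x y) <= eps.
Proof.
move=> hu hv e e0; have [N [B [B0 hB]]] := hcvg_bounded hu.
have e1 : 0 < e / 2 / (B + 1) by rewrite !divr_gt0 // ltr_wpDl.
have e2 : 0 < e / 2 / (hn y + 1) by rewrite !divr_gt0 // ltr_wpDl // hn_ge0.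
have [N1 h1] := (hcvgP _ _).1 hv _ e1; have [N2 h2] := (hcvgP _ _).1 hu _ e2.
exists (maxn N (maxn N1 N2)) => n; rewrite !geq_max => /and3P[/hB a /h1 b /h2 c].
have -> : ip (u n) (v n) - ip x y = ip (u n) (v n - y) + ip (u n - x) y.
  by rewrite ipBr ipBl addrA subrK.
apply: le_trans (le_normcD _ _) _.
rewrite !ltr_pdivlMr ?ltr_wpDl ?hn_ge0 // in b c.
have k1 := cauchy_schwarz (u n) (v n - y); have k2 := cauchy_schwarz (u n - x) y.
have p1 := hn_ge0 (u n); have p2 := hn_ge0 (v n - y); have p3 := hn_ge0 y.
have p4 := hn_ge0 (u n - x); nra.
Qed.

Lemma hcvg_squeeze u x (r : nat -> R) : (forall n, hn (u n - x) <= r n) ->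
  r @ \oo --> (0 : R) -> hcvg u x.
Proof.
move=> h /cvgrPdist_lt k; apply/hcvgP => e /k [N _ hN]; exists N => n /hN /=.
by rewrite sub0r normrN; apply: le_lt_trans; apply: le_trans (h n) (ler_norm _).
Qed.

End InnerProduct.

(** The tool by which adjoint relations pass from finite sums and approximants to their limits. *)
Lemma hcvg_ip_eq {R : realType} {V W : lmodType R[i]} (ipV : V -> V -> R[i])
  (ipW : W -> W -> R[i]) (u u' : nat -> V) (v v' : nat -> W) x x' y y' :
  inner_product ipV -> inner_product ipW ->
  hcvg ipV u x -> hcvg ipV u' x' -> hcvg ipW v y -> hcvg ipW v' y' ->
  (forall n, ipV (u n) (u' n) = ipW (v n) (v' n)) -> ipV x x' = ipW y y'.
Proof.
move=> hV hW hu hu' hv hv' h; apply: normc_eq_eps => e e0.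
have e2 : 0 < e / 2 by rewrite divr_gt0.
have [N1 h1] := hcvg_ip hV hu hu' e2; have [N2 h2] := hcvg_ip hW hv hv' e2.
have := h1 (maxn N1 N2) (leq_maxl _ _); have := h2 (maxn N1 N2) (leq_maxr _ _).
rewrite h => a; rewrite -normcN opprB => b.
set m := ipW _ _ in a b.
have -> : ipV x x' - ipW y y' = (ipV x x' - m) + (m - ipW y y') by rewrite addrA subrK.
apply: le_trans (le_normcD _ _) _; lra.
Qed.

(** * Real sequences: monotone convergence and small tails *)

Section RealSequences.
Context {R : realType}.

Lemma ge0_sumr_ltn (f : nat -> R) m n : (forall k, 0 <= f k) -> (m <= n)%N ->
  \sum_(j < m) f j <= \sum_(j < n) f j.
Proof.
move=> f0 mn; rewrite -(subnK mn) addnC big_split_ord /= lerDl.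
exact: sumr_ge0.
Qed.

Lemma cvg_le (s : nat -> R) (l B : R) : s @ \oo --> l -> (forall n, s n <= B) -> l <= B.
Proof. move=> k h; rewrite -(cvg_lim _ k) //; apply: limr_le; first exact: cvgP k.
exact: nearW. Qed.

(* From [0 <= \sum_j (B2 * f j - AB * g j)^2]. *)
Lemma sum_cauchy_schwarz n (f g : nat -> R) :
  (\sum_(j < n) f j * g j) ^+ 2 <= (\sum_(j < n) f j ^+ 2) * (\sum_(j < n) g j ^+ 2).
Proof.
set AB := \sum_(j < n) f j * g j; set A2 := \sum_(j < n) f j ^+ 2.
set B2 := \sum_(j < n) g j ^+ 2.
have B0 : 0 <= B2 by apply: sumr_ge0 => j _; rewrite sqr_ge0.
have [B20|B20] := eqVneq B2 0.
  suff -> : AB = 0 by rewrite B20 mulr0 expr0n.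
  apply: big1 => j _; have /eqP := B20.
  rewrite /B2 psumr_eq0 => [/allP /(_ j (mem_index_enum _))|i _]; last by rewrite sqr_ge0.
  by rewrite /= sqrf_eq0 => /eqP ->; rewrite mulr0.
have hB : 0 < B2 by rewrite lt_def B20.
have h : 0 <= \sum_(j < n) (B2 * f j - AB * g j) ^+ 2.
  by apply: sumr_ge0 => j _; rewrite sqr_ge0.
have E : \sum_(j < n) (B2 * f j - AB * g j) ^+ 2 = B2 * (A2 * B2 - AB ^+ 2).
  transitivity (\sum_(j < n) (B2 ^+ 2 * f j ^+ 2 - (2 * B2 * AB) * (f j * g j) + AB ^+ 2 * g j ^+ 2)).
    by apply: eq_bigr => j _; ring.
  rewrite big_split /= sumrB -!mulr_sumr -/AB -/A2 -/B2; ring.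
by rewrite E pmulr_rge0 ?subr_ge0 in h.
Qed.

Lemma cvg_sum_ord n (f : nat -> nat -> R) (l : nat -> R) :
  (forall j, (j < n)%N -> f j @ \oo --> l j) ->
  (fun k => \sum_(j < n) f j k) @ \oo --> \sum_(j < n) l j.
Proof.
elim: n => [|n IH] h.
  by under eq_fun do rewrite big_ord0; rewrite big_ord0; exact: cvg_cst.
under eq_fun do rewrite big_ord_recr; rewrite big_ord_recr /=.
by apply: cvgD; [apply: IH => j jn; apply: h; exact: ltnW|exact: h].
Qed.

Lemma nondecr_bounded_cvg (s : nat -> R) (B : R) :
  (forall m n, (m <= n)%N -> s m <= s n) -> (forall n, s n <= B) ->
  exists l : R, s @ \oo --> l.
Proof.
move=> h b; exists (sup (range s)); apply: nondecreasing_cvgn.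
  by move=> m n; apply: h.
by exists B => _ [n _ <-].
Qed.

Lemma nondecr_cvg_ge (s : nat -> R) (l : R) :
  (forall m n, (m <= n)%N -> s m <= s n) -> s @ \oo --> l -> forall n, s n <= l.
Proof.
move=> h k n; rewrite -(cvg_lim _ k) //.
by apply: nondecreasing_cvgn_le => [i j|]; [exact: h|exact: cvgP k].
Qed.

Lemma nondecr_bounded_tail (s : nat -> R) (B : R) :
  (forall m n, (m <= n)%N -> s m <= s n) -> (forall n, s n <= B) ->
  forall eps, 0 < eps -> exists N, forall m n, (N <= m)%N -> (m <= n)%N -> s n - s m < eps.
Proof.
move=> h b e e0; have [l hl] := nondecr_bounded_cvg h b.
have hle := nondecr_cvg_ge h hl.
move/cvgrPdist_lt: hl => /(_ _ e0) [N _ hN]; exists N => m n Nm mn.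
have := hN _ Nm; rewrite /= ger0_norm ?subr_ge0 //; have := hle n; lra.
Qed.

End RealSequences.

(** * Finite orthonormal families and complete orthonormal systems *)

Section OrthonormalFamilies.
Context {R : realType} {V : lmodType R[i]} {ip : V -> V -> R[i]}.
Hypothesis hip : inner_product ip.
Local Notation hn := (hnorm ip).
Local Notation hcvg := (hcvg ip).

(** A sequence with a bound, rather than a function on ordinals, so that initial segments and shifts
    of a complete orthonormal system are instances. *)
Definition onfam (d : nat) (u : nat -> V) : Prop :=
  forall i j, (i < d)%N -> (j < d)%N -> ip (u i) (u j) = (i == j)%:R.

Definition onproj (d : nat) (u : nat -> V) (x : V) : V :=
  \sum_(i < d) ip (u i) x *: u i.

Lemma onfam_coef d u (c : nat -> R[i]) i : onfam d u -> (i < d)%N ->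
  ip (u i) (\sum_(j < d) c j *: u j) = c i.
Proof.
move=> hu id; rewrite (ip_sumr hip) (bigD1 (Ordinal id)) //= (ipZr hip) hu // eqxx mulr1.
rewrite big1 ?addr0 // => j /eqP ji; rewrite (ipZr hip) hu //.
case: eqP => [ij|_]; last by rewrite mulr0.
by case: ji; apply: val_inj.
Qed.

Lemma hn_onfam d u i : onfam d u -> (i < d)%N -> hn (u i) = 1.
Proof. by move=> hu id; rewrite /hnorm hu // eqxx sqrtr1. Qed.

Lemma hn2_onsum d u (c : nat -> R[i]) : onfam d u ->
  hn (\sum_(j < d) c j *: u j) ^+ 2 = \sum_(j < d) normc (c j) ^+ 2.
Proof.
move=> hu; rewrite (hn2_sum_orth hip (f := fun j => c j *: u j)).
  by apply: eq_bigr => j _; rewrite (hnZ hip) (hn_onfam hu) // mulr1.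
move=> i j id jd ij; rewrite (ipZr hip) (ipZl hip) hu // (negbTE ij).
by rewrite !mulr0.
Qed.

Lemma ip_sub_onproj d u x i : onfam d u -> (i < d)%N -> ip (u i) (x - onproj d u x) = 0.
Proof. by move=> hu id; rewrite (ipBr hip) (onfam_coef (fun j => ip (u j) x)) // subrr. Qed.

Lemma hn2_onproj d u x : onfam d u ->
  hn x ^+ 2 = \sum_(j < d) normc (ip (u j) x) ^+ 2 + hn (x - onproj d u x) ^+ 2.
Proof.
move=> hu; rewrite -(hn2_onsum (fun j => ip (u j) x) hu) -(hn2_orth hip).
  by rewrite addrC subrK.
rewrite (ip_suml hip) big1 // => -[i id] _ /=.
by rewrite (ipZl hip) ip_sub_onproj // mulr0.
Qed.

Lemma bessel d u x : onfam d u ->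
  \sum_(j < d) normc (ip (u j) x) ^+ 2 <= hn x ^+ 2.
Proof. by move=> hu; rewrite (hn2_onproj x hu) lerDl sqr_ge0. Qed.

Lemma parseval_fin d u x : onfam d u -> x = onproj d u x ->
  hn x ^+ 2 = \sum_(j < d) normc (ip (u j) x) ^+ 2.
Proof. by move=> hu hx; rewrite (hn2_onproj x hu) -hx subrr (hn0 hip) expr0n addr0. Qed.

(** Reduces estimates about finitely many vectors to a finite orthonormal family that reproduces all
    of them, whatever the dimension of the space. *)
Lemma gram_schmidt (xs : seq V) :
  exists d u, onfam d u /\ {in xs, forall x, x = onproj d u x}.
Proof.
elim: xs => [|x xs [d [u [hu IH]]]]; first by exists 0%N, (fun=> 0).
have [r0|r0] := eqVneq (x - onproj d u x) 0.
  exists d, u; split => // y; rewrite inE => /orP[/eqP ->|/IH //].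
  by apply/eqP; rewrite -subr_eq0 r0.
set r := x - onproj d u x in r0.
have hr0 : hn r != 0 by apply: contra_neq r0 => /(hn0_eq hip).
have hr : 0 < hn r by rewrite lt_def hr0 hn_ge0.
pose v := ((hn r)^-1)%:C%C *: r.
pose u' k := if k == d then v else u k.
have uE k : (k < d)%N -> u' k = u k by rewrite /u' => /ltn_eqF ->.
have udE : u' d = v by rewrite /u' eqxx.
have uv k : (k < d)%N -> ip (u k) v = 0.
  by move=> kd; rewrite (ipZr hip) ip_sub_onproj // mulr0.
have vv : ip v v = 1.
  rewrite -(hn2E hip) (hnZ hip) normc_real ger0_norm ?invr_ge0 ?hn_ge0 //.
  by rewrite mulVf // expr1n.
have hu' : onfam d.+1 u'.
  move=> i j; rewrite !ltnS leq_eqVlt => /orP[/eqP ->|id];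
    rewrite leq_eqVlt => /orP[/eqP ->|jd].
  - by rewrite udE eqxx.
  - by rewrite udE uE // (ipC hip) uv // conjC0 gtn_eqF.
  - by rewrite udE uE // uv // ltn_eqF.
  - by rewrite !uE // hu.
have projE y : onproj d.+1 u' y = onproj d u y + ip v y *: v.
  rewrite /onproj big_ord_recr /= udE; congr (_ + _).
  by apply: eq_bigr => i _; rewrite uE.
have vx : ip v x = (hn r)%:C%C.
  have -> : x = r + onproj d u x by rewrite subrK.
  rewrite (ipDr hip) (ip_sumr hip) big1 ?addr0 => [|[i id] _ /=]; last first.
    by rewrite (ipZr hip) (ipC hip _ v) uv // conjC0 mulr0.
  rewrite (ipZl hip) conj_realc -(hn2E hip) -realcM expr2 mulrA mulVf //.
  by rewrite mul1r.
exists d.+1, u'; split => // y; rewrite inE projE => /orP[/eqP ->|/IH yE].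
  by rewrite vx scalerA -realcM mulfV // scale1r addrC subrK.
have -> : ip v y = 0.
  rewrite yE (ip_sumr hip) big1 // => -[i id] _ /=.
  by rewrite (ipZr hip) (ipC hip _ v) uv // conjC0 mulr0.
by rewrite scale0r addr0.
Qed.

Lemma orthonormal_onfam e d : orthonormal ip e -> onfam d e.
Proof. by move=> h i j _ _; apply: h. Qed.

Lemma onfam_shift e k d : orthonormal ip e -> onfam d (fun j => e (k + j)%N).
Proof. by move=> h i j _ _; rewrite h eqn_add2l. Qed.

Hypothesis hcomplete : forall u, hcauchy ip u -> exists x, hcvg u x.

Lemma hn_lt_sqr x (e : R) : 0 < e -> hn x ^+ 2 < e ^+ 2 -> hn x < e.
Proof. by move=> e0; rewrite ltr_pXn2r ?nnegrE ?hn_ge0 ?ltW. Qed.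

(** Common form of the Cauchy arguments below: [s] is the sequence of partial sums of a bounded
    series of squares, and the increments of [u] are controlled by its tails. *)
Lemma hcauchy_dominated (u : nat -> V) (s : nat -> R) (A B : R) : 0 <= A ->
  (forall m n, (m <= n)%N -> s m <= s n) -> (forall n, s n <= B) ->
  (forall m n, (m <= n)%N -> hn (u n - u m) ^+ 2 <= A * (s n - s m)) -> hcauchy ip u.
Proof.
move=> A0 sm sB us e e0.
have e2 : 0 < e ^+ 2 / (A + 1) by rewrite divr_gt0 ?exprn_gt0 // ltr_wpDl.
have [N hN] := nondecr_bounded_tail sm sB e2; exists N.
have key m n : (N <= m)%N -> (m <= n)%N -> hn (u n - u m) < e.
  move=> Nm mn; apply: hn_lt_sqr => //; apply: le_lt_trans (us _ _ mn) _.
  have := hN _ _ Nm mn; rewrite ltr_pdivlMr ?ltr_wpDl //.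
  by have := sm _ _ mn; nra.
move=> m n Nm Nn; case/orP: (leq_total m n) => mn; last exact: key.
by rewrite (hnBC hip); apply: key.
Qed.

Lemma riesz_fischer e (c : nat -> R[i]) (B : R) : orthonormal ip e ->
  (forall n, \sum_(j < n) normc (c j) ^+ 2 <= B) ->
  exists x, hcvg (fun n => \sum_(j < n) c j *: e j) x.
Proof.
move=> he hB; apply: hcomplete.
apply: (hcauchy_dominated (s := fun n => \sum_(j < n) normc (c j) ^+ 2) (A := 1)) hB _ => //.
  by move=> m n; apply: (ge0_sumr_ltn (f := fun j => normc (c j) ^+ 2)) => k; rewrite sqr_ge0.
move=> m n mn; rewrite mul1r -(subnK mn) [(n - m + m)%N]addnC !big_split_ord /=.
rewrite [X in hn X]addrC addKr [X in _ <= X]addrC addKr.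
by rewrite (hn2_onsum (fun j => c (m + j)%N) (onfam_shift m he)).
Qed.

Lemma cons_expansion e x : cons_ ip e -> hcvg (fun n => onproj n e x) x.
Proof.
move=> [he hc].
have [n|y hy] := riesz_fischer (c := fun j => ip (e j) x) (B := hn x ^+ 2) he.
  by apply: bessel; apply: orthonormal_onfam.
suff xy : x = y by move: hy; rewrite -xy.
apply/eqP; rewrite -subr_eq0; apply/eqP/hc => j; rewrite (ipBr hip).
apply/eqP; rewrite subr_eq0; apply/eqP.
(* The shift makes every partial sum contain the index [j], so that its [j]-th coefficient is
   constant along the sequence. *)
have hyj : hcvg (fun n => onproj (n + j.+1) e x) y.
  apply/hcvgP => eps eps0; have [N hN] := (hcvgP _ _).1 hy _ eps0.
  by exists N => n Nn; apply: hN; apply: leq_trans Nn (leq_addr _ _).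
apply: (hcvg_ip_eq hip hip (hcvg_cst hip (e j)) (hcvg_cst hip x) (hcvg_cst hip (e j)) hyj).
move=> n; rewrite (onfam_coef (d := n + j.+1) (fun j => ip (e j) x)) //.
by rewrite addnS ltnS leq_addl.
Qed.

Lemma parseval e x : cons_ ip e ->
  (fun n => \sum_(j < n) normc (ip (e j) x) ^+ 2) @ \oo --> hn x ^+ 2.
Proof.
move=> he; have := cons_expansion x he; rewrite /hcvg => h.
have -> : (fun n => \sum_(j < n) normc (ip (e j) x) ^+ 2) =
          (fun n => hn x ^+ 2 - hn (onproj n e x - x) ^+ 2).
  apply/funext => n; rewrite (hnBC hip) (hn2_onproj (d := n) (u := e)) ?addrK //.
  by apply: orthonormal_onfam; case: he.
rewrite -[X in _ --> X]subr0; apply: cvgB; first exact: cvg_cst.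
have -> : (fun n => hn (onproj n e x - x) ^+ 2) = (fun n => hn (onproj n e x - x)) \* (fun n => hn (onproj n e x - x)).
  by apply/funext => n; rewrite expr2.
by rewrite -(mulr0 0); apply: cvgM.
Qed.

End OrthonormalFamilies.

Arguments onfam {R V} ip d u.
Arguments onproj {R V} ip d u x.

(** * Hilbert-Schmidt operators and conjugations *)

Section LinearMaps.
Context {R : realType} {V W : lmodType R[i]}.
Variable A : V -> W.
Hypothesis linA : forall (c : R[i]) x y, A (c *: x + y) = c *: A x + A y.

Lemma lin0 : A 0 = 0.
Proof. by have := linA (-1) 0 0; rewrite !scaleN1r !addNr. Qed.

Lemma linD x y : A (x + y) = A x + A y.
Proof. by have := linA 1 x y; rewrite !scale1r. Qed.

Lemma linZ c x : A (c *: x) = c *: A x.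
Proof. by have := linA c x 0; rewrite lin0 !addr0. Qed.

Lemma linB x y : A (x - y) = A x - A y.
Proof. by rewrite linD -scaleN1r linZ scaleN1r. Qed.

Lemma lin_sum n (f : nat -> V) : A (\sum_(i < n) f i) = \sum_(i < n) A (f i).
Proof. exact: (big_morph A linD lin0). Qed.

End LinearMaps.

Section HilbertSchmidt.
Context {R : realType} {V : lmodType R[i]} {ip : V -> V -> R[i]}.
Hypothesis hilb : hilbert ip.
Let hip : inner_product ip := hilb.1.
Local Notation hn := (hnorm ip).
Local Notation hcvg := (hcvg ip).

Lemma bounded_op_hcvg A u x : bounded_op ip A -> hcvg u x -> hcvg (fun n => A (u n)) (A x).
Proof.
move=> [linA [M hM]] hu; apply: (hcvg_squeeze (r := fun n => M * hn (u n - x))).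
  by move=> n; rewrite -(linB linA); apply: hM.
by rewrite -(mulr0 M); apply: cvgM => //; exact: cvg_cst.
Qed.

Lemma adjointP (A B : V -> V) : (forall x y, ip (A x) y = ip x (B y)) ->
  forall x y, ip (A x) y = ip x (adjoint ip A y).
Proof.
move=> h; exact: (epsilon_spec (inhabits A)
  (fun B' => forall x y, ip (A x) y = ip x (B' y)) (ex_intro _ B h)).
Qed.

Lemma ip_ext x y : (forall z, ip z x = ip z y) -> x = y.
Proof.
move=> h; apply/eqP; rewrite -subr_eq0; apply/eqP/(hn0_eq hip).
by rewrite /hnorm (ipBr hip) h subrr sqrtr0.
Qed.

(** The value chosen by [adjoint] is forced, because vectors with the same pairings are equal. *)
Lemma adjointE (A B : V -> V) : (forall x y, ip (A x) y = ip x (B y)) -> adjoint ip A = B.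
Proof.
move=> h; apply/funext => y; apply: ip_ext => x.
by rewrite -(adjointP h).
Qed.

Lemma adjoint_lin (A B : V -> V) : (forall x y, ip (A x) y = ip x (B y)) ->
  forall (c : R[i]) x y, B (c *: x + y) = c *: B x + B y.
Proof.
move=> h c x y; apply: ip_ext => z.
by rewrite -h (ipDr hip) (ipZr hip) !h -(ipZr hip) -(ipDr hip).
Qed.

(* Sum over [j] of [|A^* u_j|^2] is the double sum of the [|(A e_k, u_j)|^2],
   which Bessel's inequality for [u] bounds by the sum of the [|A e_k|^2]. *)
Lemma hs_bound_adjoint (A B : V -> V) e (s : R) : (forall x y, ip (A x) y = ip x (B y)) ->
  cons_ ip e -> (forall n, \sum_(k < n) hn (A (e k)) ^+ 2 <= s) ->
  forall d u, onfam ip d u -> \sum_(j < d) hn (B (u j)) ^+ 2 <= s.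
Proof.
move=> h he hs d u hu.
have hl : (fun n => \sum_(j < d) \sum_(k < n) normc (ip (e k) (B (u j))) ^+ 2) @ \oo
          --> \sum_(j < d) hn (B (u j)) ^+ 2.
  apply: (cvg_sum_ord (f := fun j n => \sum_(k < n) normc (ip (e k) (B (u j))) ^+ 2)
    (l := fun j => hn (B (u j)) ^+ 2)) => j _.
  by apply: parseval => //; exact: hilb.2.
apply: (cvg_le hl) => n; rewrite exchange_big /=; apply: le_trans (hs n).
apply: ler_sum => k _; apply: le_trans (bessel hip (A (e k)) hu).
by apply: ler_sum => j _; rewrite -h (ipC hip) normcJ.
Qed.

Lemma sum_hn2_le (f : nat -> V) m n : (m <= n)%N ->
  \sum_(j < m) hn (f j) ^+ 2 <= \sum_(j < n) hn (f j) ^+ 2.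
Proof. by apply: (ge0_sumr_ltn (f := fun j => hn (f j) ^+ 2)) => k; rewrite sqr_ge0. Qed.

Lemma hs_series_ge A e s : hs_series ip A e s ->
  forall n, \sum_(j < n) hn (A (e j)) ^+ 2 <= s.
Proof.
by move=> hs; apply: (nondecr_cvg_ge _ hs) => m n; apply: (sum_hn2_le (fun j => A (e j))).
Qed.

(** The adjoint is built from its coefficients [(e_j, B y) = (A e_j, y)]. They are square summable
    because the [|A e_j|^2] are summable, so Riesz-Fischer provides the vector [B y]. *)
Lemma hs_adjoint_ex A : hilbert_schmidt ip A -> exists B, forall x y, ip (A x) y = ip x (B y).
Proof.
move=> [bA [e [s [he hs]]]].
have hle := hs_series_ge hs.
have /choice[B hB] : forall y, exists z,
    hcvg (fun n => \sum_(j < n) ip (A (e j)) y *: e j) z.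
  move=> y; apply: (riesz_fischer hip hilb.2 (c := fun j => ip (A (e j)) y) (B := s * hn y ^+ 2) he.1) => n.
  apply: le_trans (ler_wpM2r (sqr_ge0 _) (hle n)); rewrite mulr_suml.
  apply: ler_sum => j _; rewrite -exprMn lerXn2r ?nnegrE ?mulr_ge0 ?normc_ge0 ?hn_ge0 //.
  exact: cauchy_schwarz.
exists B => x y; have hx := cons_expansion hip hilb.2 x he.
apply: (hcvg_ip_eq hip hip (bounded_op_hcvg bA hx) (hcvg_cst hip y) hx (hB y)) => n.
rewrite /onproj (lin_sum bA.1 n (fun i => ip (e i) x *: e i)) (ip_suml hip) [RHS](ip_suml hip).
apply: eq_bigr => -[i lt_in] _ /=; rewrite (linZ bA.1) !(ipZl hip).
by rewrite (onfam_coef hip (d := n) (fun j => ip (A (e j)) y)) //; exact: orthonormal_onfam he.1.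
Qed.

(** Passing to the adjoint and back replaces the given complete system by an arbitrary orthonormal
    family, with the same constant. *)
Lemma hs_bounded A : hilbert_schmidt ip A -> exists2 s : R, 0 <= s &
  forall d u, onfam ip d u -> \sum_(j < d) hn (A (u j)) ^+ 2 <= s.
Proof.
move=> hA; have [B hB] := hs_adjoint_ex hA; have [bA [e [s [he hs]]]] := hA.
have hle := hs_series_ge hs.
have hB' x y : ip (B x) y = ip x (A y) by rewrite (ipC hip) -hB -(ipC hip).
exists s; first by have := hle 0%N; rewrite big_ord0.
apply: (hs_bound_adjoint hB' he) => n; apply: (hs_bound_adjoint hB he) => //.
exact: orthonormal_onfam he.1.
Qed.

Lemma hs_norm_ge A : hilbert_schmidt ip A -> forall d u, onfam ip d u ->
  \sum_(j < d) hn (A (u j)) ^+ 2 <= hs_norm ip A ^+ 2.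
Proof.
move=> hA; have [B hB] := hs_adjoint_ex hA; have [bA [e [s [he hs]]]] := hA.
have hB' x y : ip (B x) y = ip x (A y) by rewrite (ipC hip) -hB -(ipC hip).
have all_le e' s' : cons_ ip e' -> hs_series ip A e' s' ->
    forall d u, onfam ip d u -> \sum_(j < d) hn (A (u j)) ^+ 2 <= s'.
  move=> he' hs'; apply: (hs_bound_adjoint hB' he') => n; apply: (hs_bound_adjoint hB he') => //.
    exact: (hs_series_ge hs').
  exact: orthonormal_onfam he'.1.
(* The supremum is meaningful because [s] itself bounds the series of every other complete
   system. *)
have sup_ge : s <= sup [set s' | exists e', cons_ ip e' /\ hs_series ip A e' s'].
  apply: ub_le_sup; last by exists e.
  exists s => s' [e' [he' hs']]; apply: (cvg_le hs') => n.
  by apply: (all_le e s) => //; exact: orthonormal_onfam he'.1.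
have s0 : 0 <= s by have := hs_series_ge hs 0%N; rewrite big_ord0.
move=> d u hu; rewrite sqr_sqrtr ?(le_trans s0) //; apply: le_trans sup_ge.
exact: (all_le e s).
Qed.

Lemma opnorm_ge A : bounded_op ip A -> forall x, hn (A x) <= opnorm ip A * hn x.
Proof.
move=> [linA [M hM]] x.
have [x0|x0] := eqVneq (hn x) 0.
  by rewrite (hn0_eq hip x0) (lin0 linA) (hn0 hip) mulr0.
have hx : 0 < hn x by rewrite lt_def x0 hn_ge0.
rewrite -ler_pdivrMr //.
have -> : hn (A x) / hn x = hn (A (((hn x)^-1)%:C%C *: x)).
  by rewrite (linZ linA) (hnZ hip) normc_real ger0_norm ?invr_ge0 ?hn_ge0 // mulrC.
apply: ub_le_sup; last first.
  exists (((hn x)^-1)%:C%C *: x) => //=.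
  by rewrite (hnZ hip) normc_real ger0_norm ?invr_ge0 ?hn_ge0 // mulVf.
(* The constant in [bounded_op] carries no sign condition, hence the absolute value. *)
exists `|M| => _ [y /= y1 <-]; apply: le_trans (hM y) _.
apply: le_trans (ler_norm _) _; rewrite normrM -[leRHS]mulr1.
by rewrite ler_wpM2l // ger0_norm ?hn_ge0.
Qed.

(** From [|B y|^2 = (A B y, y)] by Cauchy-Schwarz, after cancelling one factor [|B y|]. *)
Lemma opnorm_adjoint_ge A B : bounded_op ip A -> (forall x y, ip (A x) y = ip x (B y)) ->
  forall y, hn (B y) ^+ 2 <= opnorm ip A ^+ 2 * hn y ^+ 2.
Proof.
move=> bA h y.
have o0 : 0 <= opnorm ip A * hn y.
  have [y0|y0] := eqVneq (hn y) 0; first by rewrite y0 mulr0.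
  by apply: le_trans (opnorm_ge bA y); rewrite hn_ge0.
rewrite -exprMn lerXn2r ?nnegrE ?hn_ge0 //.
apply: sqr_le_mul_le => //; first exact: hn_ge0.
have E : hn (B y) ^+ 2 = normc (ip (A (B y)) y).
  by rewrite h -(hn2E hip) normc_real ger0_norm ?sqr_ge0.
rewrite E; apply: le_trans (cauchy_schwarz hip _ _) _.
have := opnorm_ge bA (B y); have : 0 <= hn y := hn_ge0 _; nra.
Qed.

Lemma adjoint_hs A B : hilbert_schmidt ip A -> (forall x y, ip (A x) y = ip x (B y)) ->
  hilbert_schmidt ip B.
Proof.
move=> hA h; have [s _ hs] := hs_bounded hA; have [bA [e [_ [he _]]]] := hA.
split.
  split; first exact: adjoint_lin h.
  exists `|opnorm ip A| => y.
  rewrite -(@ler_pXn2r _ 2) ?nnegrE ?mulr_ge0 ?hn_ge0 // exprMn real_normK ?num_real //.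
  exact: opnorm_adjoint_ge.
have [l hl] : exists l : R, (fun n => \sum_(j < n) hn (B (e j)) ^+ 2) @ \oo --> l.
  apply: (nondecr_bounded_cvg (B := s)) => [m n|n]; first exact: sum_hn2_le (fun j => B (e j)) _ _.
  apply: (hs_bound_adjoint h he) => [m|]; first by apply: hs; exact: orthonormal_onfam he.1.
  exact: orthonormal_onfam he.1.
by exists e, l.
Qed.

(** * Conjugations and transposes *)

Section Conjugation.
Context {J : V -> V}.
Hypothesis hJ : conjugation ip J.

Lemma conjD x y : J (x + y) = J x + J y. Proof. by case: hJ. Qed.
Lemma conjZ c x : J (c *: x) = c^* *: J x. Proof. by case: hJ. Qed.
Lemma conjK x : J (J x) = x. Proof. by case: hJ. Qed.
Lemma conj_ip x y : ip (J x) (J y) = ip y x. Proof. by case: hJ. Qed.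
Lemma conj_ipl x y : ip (J x) y = ip (J y) x. Proof. by rewrite -{1}(conjK y) conj_ip. Qed.
Lemma conj_ipr x y : ip x (J y) = ip y (J x). Proof. by rewrite -{1}(conjK x) conj_ip. Qed.
Lemma conj0 : J 0 = 0. Proof. by have := conjZ 0 0; rewrite conjC0 !scale0r. Qed.
Lemma conjN x : J (- x) = - J x.
Proof. by rewrite -scaleN1r conjZ rmorphN1 scaleN1r. Qed.
Lemma conj_sum n (f : nat -> V) : J (\sum_(i < n) f i) = \sum_(i < n) J (f i).
Proof. exact: (big_morph J conjD conj0). Qed.
Lemma hn_conj x : hn (J x) = hn x. Proof. by apply: hn2_eq; rewrite conj_ip. Qed.

Lemma conj_hcvg u x : hcvg u x -> hcvg (fun n => J (u n)) (J x).
Proof.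
rewrite /Defs.hcvg; suff -> : (fun n => hn (J (u n) - J x)) = (fun n => hn (u n - x)) by [].
by apply: funext => n; rewrite -conjN -conjD hn_conj.
Qed.

Lemma conj_orthonormal e : orthonormal ip e -> orthonormal ip (fun j => J (e j)).
Proof. by move=> he i j; rewrite conj_ip he eq_sym. Qed.

Lemma conj_cons e : cons_ ip e -> cons_ ip (fun j => J (e j)).
Proof.
move=> [he hc]; split; first exact: conj_orthonormal.
move=> x hx; rewrite -(conjK x) (hc (J x)) ?conj0 // => j.
by rewrite conj_ipr (ipC hip) hx conjC0.
Qed.

Lemma cbar_hs A : hilbert_schmidt ip A -> hilbert_schmidt ip (cbar J A).
Proof.
move=> [[linA [M hM]] [e [s [he hs]]]]; split.
  split=> [c x y|]; first by rewrite /cbar conjD conjZ linA conjD conjZ conjCK.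
  by exists M => x; rewrite /cbar hn_conj -(hn_conj x); apply: hM.
exists (fun j => J (e j)), s; split; first exact: conj_cons.
rewrite /hs_series /cbar.
suff -> : (fun M => \sum_(j < M) hn (J (A (J (J (e j))))) ^+ 2) =
          (fun M => \sum_(j < M) hn (A (e j)) ^+ 2) by [].
by apply: funext => n; apply: eq_bigr => j _; rewrite conjK hn_conj.
Qed.

Lemma cbar_adjoint A B : (forall x y, ip (A x) y = ip x (B y)) ->
  forall x y, ip (cbar J A x) y = ip x (cbar J B y).
Proof. by move=> h x y; rewrite /cbar conj_ipl (ipC hip) h -(ipC hip) conj_ipr. Qed.

(** Replaces the transpose, a choice by [epsilon], by the explicit map [J B J] with [B] the adjoint
    of [A]. *)
Lemma transpE A B : (forall x y, ip (A x) y = ip x (B y)) -> transp ip J A = cbar J B.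
Proof. by move=> h; apply: adjointE; exact: cbar_adjoint. Qed.

Lemma transp_hs A B : hilbert_schmidt ip A -> (forall x y, ip (A x) y = ip x (B y)) ->
  hilbert_schmidt ip (cbar J B).
Proof.
move=> hA h; apply: (adjoint_hs (A := cbar J A)); first exact: cbar_hs.
exact: cbar_adjoint.
Qed.

End Conjugation.
End HilbertSchmidt.

(** * The creation vectors *)

Section Span.
Context {R : realType} {V : lmodType R[i]}.
Implicit Types (S T : set V).

Lemma hspan_ind S (P : V -> Prop) : P 0 ->
  (forall c v x, S v -> P x -> P (c *: v + x)) -> forall x, hspan S x -> P x.
Proof.
move=> P0 PS x [n]; elim: n x => [|n IH] x [c [v [Sv ->]]]; first by rewrite big_ord0.
rewrite big_ord_recl; apply: PS => //; apply: IH.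
by exists (fun i => c (lift ord0 i)), (fun i => v (lift ord0 i)).
Qed.

Lemma hspan0 S : hspan S 0.
Proof. by exists 0%N, (fun=> 0), (fun=> 0); split; [case|rewrite big_ord0]. Qed.

Lemma hspan_cons S c v x : S v -> hspan S x -> hspan S (c *: v + x).
Proof.
move=> Sv [n [d [w [Sw ->]]]].
exists n.+1, (fun i => if unlift ord0 i is Some j then d j else c),
  (fun i => if unlift ord0 i is Some j then w j else v); split=> [i|].
  by case: unliftP.
rewrite big_ord_recl unlift_none; congr (_ + _); apply: eq_bigr => i _.
by rewrite liftK.
Qed.

Lemma hspan_sub S v : S v -> hspan S v.
Proof. by move=> Sv; rewrite -[v]scale1r -[_ *: _]addr0; apply: hspan_cons (hspan0 S). Qed.

Lemma hspan_lin S c x y : hspan S x -> hspan S y -> hspan S (c *: x + y).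
Proof.
move=> hx hy; elim/(@hspan_ind S): x / hx => [|d v x Sv IH]; first by rewrite scaler0 add0r.
by rewrite scalerDr scalerA -addrA; apply: hspan_cons.
Qed.

Lemma hspanD S x y : hspan S x -> hspan S y -> hspan S (x + y).
Proof. by rewrite -{2}[x]scale1r; apply: hspan_lin. Qed.

Lemma hspanZ S c x : hspan S x -> hspan S (c *: x).
Proof. by move=> h; rewrite -[_ *: _]addr0; apply: hspan_lin => //; apply: hspan0. Qed.

Lemma hspanB S x y : hspan S x -> hspan S y -> hspan S (x - y).
Proof. by move=> hx hy; rewrite addrC -scaleN1r; apply: hspan_lin. Qed.

Lemma hspan_sum S n (f : nat -> V) : (forall i, (i < n)%N -> hspan S (f i)) ->
  hspan S (\sum_(i < n) f i).
Proof. by move=> h; elim/big_ind: _ => [|x y|i _]; [exact: hspan0|exact: hspanD|exact: h]. Qed.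

Lemma hspan_mono S T x : S `<=` T -> hspan S x -> hspan T x.
Proof. by move=> ST [n [c [v [Sv ->]]]]; exists n, c, v; split=> // i; apply: ST. Qed.

End Span.

(** * Commutation relations and number estimates on creation vectors *)

Section FockAlgebra.
Context {R : realType} {L F : lmodType R[i]}.
Context {ipL : L -> L -> R[i]} {J : L -> L} {ipF : F -> F -> R[i]}.
Context {a ad : L -> F -> F} {D : set F} {Om : F}.
Hypothesis hipL : inner_product ipL.
Hypothesis hJ : conjugation ipL J.
Hypothesis hipF : inner_product ipF.
Hypothesis hF : fock_rep ipL J ipF a ad D Om.
Local Notation hn := (hnorm ipF).
Local Notation hnL := (hnorm ipL).
Local Notation cvec := (cvec ad Om).
Local Notation S := (hspan (all_cvecs ad Om)).
Local Notation Sn n := (hspan (n_cvecs ad Om n)).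

Lemma D_0 : D 0. Proof. by case: hF => -[]. Qed.
Lemma D_D P Q : D P -> D Q -> D (P + Q). Proof. by case: hF => -[_ h _ _ _ _ _ _]; exact: h. Qed.
Lemma D_Z c P : D P -> D (c *: P). Proof. by case: hF => -[_ _ h _ _ _ _ _]; exact: h. Qed.
Lemma D_a f P : D P -> D (a f P). Proof. by case: hF => _ [h _ _ _] _ _ _; exact: h. Qed.
Lemma D_ad f P : D P -> D (ad f P). Proof. by case: hF => _ [_ h _ _] _ _ _; exact: h. Qed.
Lemma D_Om : D Om. Proof. by case: hF => _ _ _ _ []. Qed.

Lemma a_lin f c P Q : D P -> D Q -> a f (c *: P + Q) = c *: a f P + a f Q.
Proof. by case: hF => _ [_ _ h _] _ _ _ dP dQ; case: (h f c P Q dP dQ). Qed.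
Lemma ad_lin f c P Q : D P -> D Q -> ad f (c *: P + Q) = c *: ad f P + ad f Q.
Proof. by case: hF => _ [_ _ h _] _ _ _ dP dQ; case: (h f c P Q dP dQ). Qed.
Lemma a_linf P : D P -> forall (c : R[i]) f g, a (c *: f + g) P = c *: a f P + a g P.
Proof. by case: hF => _ [_ _ _ h] _ _ _ dP c f g; case: (h f g c P dP). Qed.
Lemma ad_linf P : D P -> forall (c : R[i]) f g, ad (c *: f + g) P = c *: ad f P + ad g P.
Proof. by case: hF => _ [_ _ _ h] _ _ _ dP c f g; case: (h f g c P dP). Qed.

Lemma a_comm f g P : D P -> a f (a g P) = a g (a f P).
Proof. by case: hF => _ _ h _ _ dP; case: (h f g P dP). Qed.
Lemma a_ad f g P : D P -> a f (ad g P) = ad g (a f P) + ipL (J f) g *: P.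
Proof.
by case: hF => _ _ h _ _ dP; case: (h f g P dP) => _ _ <-; rewrite addrC subrK.
Qed.
Lemma a_adj f P Q : D P -> D Q -> ipF (a f P) Q = ipF P (ad (J f) Q).
Proof. by case: hF => _ _ _ h _; apply: h. Qed.
Lemma ad_adj f P Q : D P -> D Q -> ipF (ad f P) Q = ipF P (a (J f) Q).
Proof. by move=> dP dQ; rewrite (ipC hipF) -{1}(conjK hJ f) -a_adj // -(ipC hipF). Qed.
Lemma a_Om f : a f Om = 0. Proof. by case: hF => _ _ _ _ []. Qed.
Lemma S_dense : hclosure ipF S = setT. Proof. by case: hF => _ _ _ _ []. Qed.

Lemma a0 f : a f 0 = 0.
Proof. by have := a_lin f (-1) D_0 D_0; rewrite !scaleN1r !addNr. Qed.
Lemma ad0 f : ad f 0 = 0.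
Proof. by have := ad_lin f (-1) D_0 D_0; rewrite !scaleN1r !addNr. Qed.
Lemma adD f P Q : D P -> D Q -> ad f (P + Q) = ad f P + ad f Q.
Proof. by move=> dP dQ; have := ad_lin f 1 dP dQ; rewrite !scale1r. Qed.
Lemma aB f P Q : D P -> D Q -> a f (P - Q) = a f P - a f Q.
Proof.
by move=> dP dQ; have := a_lin f (-1) dQ dP; rewrite !scaleN1r !(addrC (- _)).
Qed.
Lemma adB f P Q : D P -> D Q -> ad f (P - Q) = ad f P - ad f Q.
Proof.
by move=> dP dQ; have := ad_lin f (-1) dQ dP; rewrite !scaleN1r !(addrC (- _)).
Qed.

Lemma D_sum n (p : nat -> F) : (forall i, (i < n)%N -> D (p i)) -> D (\sum_(i < n) p i).
Proof. by move=> h; elim/big_ind: _ => [|x y|i _]; [exact: D_0|exact: D_D|exact: h]. Qed.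

Lemma ad_sum f n (p : nat -> F) : (forall i, D (p i)) ->
  ad f (\sum_(i < n) p i) = \sum_(i < n) ad f (p i).
Proof.
move=> h; elim: n => [|n IH]; first by rewrite !big_ord0 ad0.
by rewrite !big_ord_recr /= adD ?IH //; apply: D_sum.
Qed.

Lemma D_cvec fs : D (cvec fs).
Proof. by elim: fs => [|f fs IH]; [exact: D_Om|exact: D_ad]. Qed.

Lemma S_D P : S P -> D P.
Proof.
elim/(@hspan_ind _ _ (all_cvecs ad Om)); first exact: D_0.
by move=> c _ x [fs _ <-] dx; apply: D_D => //; apply: D_Z; apply: D_cvec.
Qed.

Lemma Sn_S n P : Sn n P -> S P.
Proof. by apply: hspan_mono => _ [fs _ <-]; exists fs. Qed.

Lemma Sn_D n P : Sn n P -> D P.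
Proof. by move=> /Sn_S /S_D. Qed.

Lemma Sn_cvec fs : Sn (size fs) (cvec fs).
Proof. by apply: hspan_sub; exists fs. Qed.

Lemma ad_Sn n f P : Sn n P -> Sn n.+1 (ad f P).
Proof.
move=> hP; have dP := Sn_D hP; move: hP dP.
(* Linearity of the operators is available on [D] only, so membership in [D] travels through the
   induction. The same device recurs below. *)
suff h : Sn n P -> D P /\ Sn n.+1 (ad f P) by move=> /h [].
elim/(@hspan_ind _ _ (n_cvecs ad Om n)) => [|c _ x [fs /= sz <-] [dx IH]].
  by rewrite ad0; split; [exact: D_0|exact: hspan0].
split; first by apply: D_D => //; apply: D_Z; apply: D_cvec.
rewrite ad_lin //; last exact: D_cvec.
by apply: hspan_cons => //; exists (f :: fs) => //=; rewrite sz.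
Qed.

Lemma a_cvec f fs : if fs is [::] then a f (cvec fs) = 0 else Sn (size fs).-1 (a f (cvec fs)).
Proof.
elim: fs => [|g fs IH] /=; first exact: a_Om.
rewrite a_ad; last exact: D_cvec.
apply: hspanD; last by apply: hspanZ; apply: Sn_cvec.
case: fs IH => [->|h fs IH]; first by rewrite ad0; apply: hspan0.
exact: ad_Sn IH.
Qed.

Lemma a_Sn n f P : Sn n.+1 P -> Sn n (a f P).
Proof.
suff h : Sn n.+1 P -> D P /\ Sn n (a f P) by move=> /h [].
elim/(@hspan_ind _ _ (n_cvecs ad Om n.+1)) => [|c _ x [fs /= sz <-] [dx IH]].
  by rewrite a0; split; [exact: D_0|exact: hspan0].
split; first by apply: D_D => //; apply: D_Z; apply: D_cvec.
rewrite a_lin //; last exact: D_cvec.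
apply: hspan_lin => //; have := a_cvec f fs; case: fs sz => [//|g fs] [sz].
by rewrite /= sz.
Qed.

Lemma a_S0 f P : Sn 0 P -> a f P = 0.
Proof.
suff h : Sn 0 P -> D P /\ a f P = 0 by move=> /h [].
elim/(@hspan_ind _ _ (n_cvecs ad Om 0)) => [|c _ x [fs /= sz <-] [dx IH]].
  by rewrite a0; split=> //; exact: D_0.
split; first by apply: D_D => //; apply: D_Z; apply: D_cvec.
rewrite a_lin //; last exact: D_cvec.
by have := a_cvec f fs; case: fs sz => // _ ->; rewrite IH scaler0 addr0.
Qed.

Lemma a_S f P : S P -> S (a f P).
Proof.
suff h : S P -> D P /\ S (a f P) by move=> /h [].
elim/(@hspan_ind _ _ (all_cvecs ad Om)) => [|c _ x [fs _ <-] [dx IH]].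
  by rewrite a0; split; [exact: D_0|exact: hspan0].
split; first by apply: D_D => //; apply: D_Z; apply: D_cvec.
rewrite a_lin //; last exact: D_cvec.
apply: hspan_lin => //; have := a_cvec f fs.
by case: fs => [->|g fs /Sn_S //]; apply: hspan0.
Qed.

Lemma ad_S f P : S P -> S (ad f P).
Proof.
suff h : S P -> D P /\ S (ad f P) by move=> /h [].
elim/(@hspan_ind _ _ (all_cvecs ad Om)) => [|c _ x [fs _ <-] [dx IH]].
  by rewrite ad0; split; [exact: D_0|exact: hspan0].
split; first by apply: D_D => //; apply: D_Z; apply: D_cvec.
rewrite ad_lin //; last exact: D_cvec.
by apply: hspan_cons => //; exists (f :: fs).
Qed.

(** Creation operators are moved one at a time to the other side, where they annihilate, until one
    of the two vectors has no particle left. *)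
Lemma Sn_orth n m P Q : Sn n P -> Sn m Q -> n <> m -> ipF P Q = 0.
Proof.
elim: n m P Q => [|n IH] m P Q hP hQ nm.
  case: m hQ nm => [//|m] hQ _.
  elim/(@hspan_ind _ _ (n_cvecs ad Om m.+1)): hQ => [|c _ x [[//|g fs] _ <-] hx].
    exact: ip0r.
  rewrite (ipDr hipF) hx (ipZr hipF) /= -{1}(conjK hJ g) -a_adj; first last.
  - exact: D_cvec.
  - exact: Sn_D hP.
  by rewrite (a_S0 _ hP) (ip0l hipF) mulr0 addr0.
elim/(@hspan_ind _ _ (n_cvecs ad Om n.+1)): hP => [|c _ x [[//|g fs] /= [sz] <-] hx].
  exact: ip0l.
rewrite (ipDl hipF) hx (ipZl hipF) ad_adj; first last.
- exact: Sn_D hQ.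
- exact: D_cvec.
case: m hQ nm => [|m] hQ nm; first by rewrite (a_S0 _ hQ) (ip0r hipF) mulr0 addr0.
rewrite (IH m) ?mulr0 ?addr0 //; [|exact: a_Sn|by move=> e; apply: nm; rewrite e].
by rewrite -sz; apply: Sn_cvec.
Qed.

Lemma S_decomp P : S P -> exists (N : nat) (p : nat -> F),
  [/\ (forall n, Sn n (p n)), (forall n, (N <= n)%N -> p n = 0) & P = \sum_(n < N) p n].
Proof.
elim/(@hspan_ind _ _ (all_cvecs ad Om)) => [|c _ x [fs _ <-] [N [p [hp p0 ->]]]].
  exists 0%N, (fun=> 0); split=> // [n|]; [exact: hspan0|by rewrite big_ord0].
pose k := size fs; pose q n := (if n == k then c *: cvec fs else 0).
pose N' := maxn k.+1 N.
have kN' : (k < N')%N by rewrite leq_maxl.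
exists N', (fun n => q n + p n); split=> [n|n|].
- apply: hspanD => //; rewrite /q; case: eqP => [->|_]; last exact: hspan0.
  by apply: hspanZ; apply: Sn_cvec.
- rewrite geq_max => /andP[kn /p0 ->]; rewrite addr0 /q gtn_eqF //.
rewrite big_split /=; congr (_ + _).
  rewrite (bigD1 (Ordinal kN')) //= big1 ?addr0 => [|i /eqP ik]; first by rewrite /q eqxx.
  by rewrite /q; case: eqP => // ik'; case: ik; apply: val_inj.
rewrite -!(big_mkord xpredT p) (@big_cat_nat _ _ _ N 0 N') //=; last by rewrite leq_maxr.
by rewrite [X in _ = _ + X]big_nat_cond [X in _ = _ + X]big1 ?addr0 // => i /andP[/andP[/p0]].
Qed.

(** The last term is the commutator; summed over a family it becomes the Hilbert-Schmidt part of the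
    estimates. *)
Lemma ad_norm f P : D P -> hn (ad f P) ^+ 2 = hn (a (J f) P) ^+ 2 + hnL f ^+ 2 * hn P ^+ 2.
Proof.
move=> dP; apply: complexI; rewrite realcD realcM !(hn2E hipF) (hn2E hipL).
rewrite ad_adj //; last exact: D_ad.
rewrite a_ad // (ipDr hipF) (ipZr hipF) (conjK hJ); congr (_ + _).
rewrite -{1}(conjK hJ f) -a_adj //; exact: D_a.
Qed.

(** On a fixed vector the number operator is a finite sum: the family has to reproduce only the
    one-particle vectors [gs] that occur in [P]. Moving [a (J (u i))] past a creator [ad f] leaves
    the sum of the [(u_i, f) u_i], which is [f] again, so each creator contributes one. *)
Lemma number_op n P : Sn n P -> exists gs : seq L, forall d u, onfam ipL d u ->
  {in gs, forall g, g = onproj ipL d u g} ->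
  \sum_(i < d) ad (u i) (a (J (u i)) P) = n%:R *: P.
Proof.
have cvecE fs : forall d u, onfam ipL d u ->
    {in fs, forall g, g = onproj ipL d u g} ->
    \sum_(i < d) ad (u i) (a (J (u i)) (cvec fs)) = (size fs)%:R *: cvec fs.
  elim: fs => [|f fs IH] d u hu hfs /=.
    by rewrite scale0r big1 // => i _; rewrite a_Om ad0.
  transitivity (\sum_(i < d) (ad f (ad (u i) (a (J (u i)) (cvec fs))) +
      ipL (u i) f *: ad (u i) (cvec fs))).
    apply: eq_bigr => i _; rewrite a_ad; last exact: D_cvec.
    have dA : D (a (J (u i)) (cvec fs)) by apply/D_a/D_cvec.
    rewrite addrC ad_lin ?(conjK hJ) 1?addrC; [|exact: D_cvec|exact: D_ad].
    congr (_ + _); case: hF => _ _ h _ _; by case: (h (u i) f _ dA) => _ -> _.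
  rewrite big_split /= -(ad_sum f d (p := fun i => ad (u i) (a (J (u i)) (cvec fs)))); last first.
    by move=> i; apply/D_ad/D_a/D_cvec.
  rewrite IH //; last by move=> g gfs; apply: hfs; rewrite inE gfs orbT.
  have -> : ad f ((size fs)%:R *: cvec fs) = (size fs)%:R *: ad f (cvec fs).
    have := ad_lin f (size fs)%:R (D_cvec fs) D_0.
    by rewrite ad0 !addr0.
  rewrite -addn1 natrD scalerDl scale1r; congr (_ + _).
  have hA := ad_linf (D_cvec fs).
  rewrite {2}(hfs f) ?inE ?eqxx // (lin_sum hA d (fun i => ipL (u i) f *: u i)).
  by apply: eq_bigr => i _; rewrite (linZ hA).
suff h : Sn n P -> D P /\ exists gs : seq L, forall d u, onfam ipL d u ->
    {in gs, forall g, g = onproj ipL d u g} ->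
    \sum_(i < d) ad (u i) (a (J (u i)) P) = n%:R *: P by move=> /h [].
elim/(@hspan_ind _ _ (n_cvecs ad Om n)) => [|c _ x [fs /= sz <-] [dx [gs IH]]].
  split; first exact: D_0.
  by exists [::] => d u _ _; rewrite scaler0 big1 // => i _; rewrite a0 ad0.
split; first by apply: D_D => //; apply: D_Z; apply: D_cvec.
exists (fs ++ gs) => d u hu h.
transitivity (\sum_(i < d) (c *: ad (u i) (a (J (u i)) (cvec fs)) + ad (u i) (a (J (u i)) x))).
  apply: eq_bigr => i _; rewrite a_lin //; last exact: D_cvec.
  by rewrite ad_lin //; apply: D_a => //; exact: D_cvec.
rewrite big_split /= -scaler_sumr cvecE // => [|g hg]; last by apply: h; rewrite mem_cat hg.
rewrite IH // => [|g hg]; last by apply: h; rewrite mem_cat hg orbT.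
by rewrite sz scalerDr !scalerA mulrC.
Qed.

(* With [u] orthonormal around all the vectors involved and [v] orthonormal
   around the [a (J (g j)) P], the coefficient [(v_l, a (J (g j)) P)] is
   [(g j, x l)] with [x l = \sum_i (v_l, a (J (u i)) P) *: u i], so the Bessel
   bound for [g] reduces the claim to the number operator
   [\sum_i ad (u i) (a (J (u i)) P) = n P]. *)
Lemma sum_a_bound n P (g : nat -> L) M (c2 : R) : Sn n P -> 0 <= c2 ->
  (forall x, \sum_(j < M) normc (ipL (g j) x) ^+ 2 <= c2 * hnL x ^+ 2) ->
  \sum_(j < M) hn (a (J (g j)) P) ^+ 2 <= c2 * n%:R * hn P ^+ 2.
Proof.
move=> hP c0 hg; have dP := Sn_D hP; have [gs hgs] := number_op hP.
have [d [u [hu uspan]]] := gram_schmidt hipL (gs ++ [seq g j | j <- iota 0 M]).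
have [e [v [hv vspan]]] := gram_schmidt hipF [seq a (J (g j)) P | j <- iota 0 M].
have numP : \sum_(i < d) hn (a (J (u i)) P) ^+ 2 = n%:R * hn P ^+ 2.
  apply: complexI; rewrite realcM realc_nat (hn2E hipF) -(ipZr hipF) -(hgs d u hu); last first.
    by move=> x xg; apply: uspan; rewrite mem_cat xg.
  rewrite realc_sum (ip_sumr hipF); apply: eq_bigr => i _.
  by rewrite (hn2E hipF) a_adj ?(conjK hJ) //; apply: D_a.
pose x l := \sum_(i < d) ipF (v l) (a (J (u i)) P) *: u i.
have coefE l j : (j < M)%N -> ipF (v l) (a (J (g j)) P) = ipL (g j) (x l).
  move=> jM; rewrite {1}(uspan (g j)); last first.
    by rewrite mem_cat map_f ?orbT // mem_iota.
  have hA := a_linf dP.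
  rewrite /onproj (conj_sum hJ d (fun i => ipL (u i) (g j) *: u i)).
  rewrite (lin_sum hA d (fun i => J (ipL (u i) (g j) *: u i))) (ip_sumr hipF) (ip_sumr hipL).
  apply: eq_bigr => i _; rewrite (conjZ hJ) (linZ hA) (ipZr hipF) (ipZr hipL).
  by rewrite -(ipC hipL) mulrC.
have E j : (j < M)%N -> hn (a (J (g j)) P) ^+ 2 = \sum_(l < e) normc (ipL (g j) (x l)) ^+ 2.
  move=> jM; rewrite (parseval_fin hipF hv (vspan _ _)).
    by apply: eq_bigr => l _; rewrite coefE.
  by apply/mapP; exists j => //; rewrite mem_iota.
under eq_bigr => j _ do rewrite E //.
rewrite exchange_big /= -mulrA -numP.
apply: le_trans (_ : \sum_(l < e) c2 * hnL (x l) ^+ 2 <= _); first exact: ler_sum.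
rewrite -mulr_sumr ler_wpM2l //.
under eq_bigr => l _ do rewrite (hn2_onsum hipL (fun i => ipF (v l) (a (J (u i)) P)) hu).
rewrite exchange_big /=; apply: ler_sum => i _; exact: bessel.
Qed.

Lemma a_bound n f P : Sn n P -> hn (a f P) ^+ 2 <= hnL f ^+ 2 * n%:R * hn P ^+ 2.
Proof.
move=> hP; have := sum_a_bound (g := fun=> J f) (M := 1) hP (sqr_ge0 (hnL f)).
rewrite big_ord1 (conjK hJ); apply=> x; rewrite big_ord1 -exprMn.
rewrite lerXn2r ?nnegrE ?mulr_ge0 ?normc_ge0 ?hn_ge0 //.
by rewrite -(hn_conj hJ f); exact: cauchy_schwarz.
Qed.

Lemma ad_bound n f P : Sn n P -> hn (ad f P) ^+ 2 <= hnL f ^+ 2 * n.+1%:R * hn P ^+ 2.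
Proof.
move=> hP; rewrite ad_norm; last exact: Sn_D hP.
rewrite -natr1 mulrDr mulr1 mulrDl lerD2r -(hn_conj hJ f); exact: a_bound.
Qed.

(* Pairing with [X] moves [a (J (g j))] onto [X] as [ad (g j)]; the sums of the
   [|ad (g j) X|^2] and of the [|a (h j) P|^2] are then bounded separately. *)
Lemma sum_aa_bound n P (g h : nat -> L) M (c2 : R) : Sn n.+2 P -> 0 <= c2 ->
  (forall x, \sum_(j < M) normc (ipL (g j) x) ^+ 2 <= c2 * hnL x ^+ 2) ->
  (forall x, \sum_(j < M) normc (ipL (J (h j)) x) ^+ 2 <= hnL x ^+ 2) ->
  hn (\sum_(j < M) a (J (g j)) (a (h j) P)) ^+ 2 <=
    (c2 * n%:R + \sum_(j < M) hnL (g j) ^+ 2) * n.+2%:R * hn P ^+ 2.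
Proof.
move=> hP c0 hg hh; have dP := Sn_D hP.
set X := \sum_(j < M) _.
have SX : Sn n X by apply: (hspan_sum (f := fun j => a (J (g j)) (a (h j) P))) => j _; do 2!apply: a_Sn.
have dX := Sn_D SX.
pose A j := hn (ad (g j) X); pose B j := hn (a (h j) P).
have XE : hn X ^+ 2 <= \sum_(j < M) A j * B j.
  have -> : hn X ^+ 2 = normc (ipF X X) by rewrite -(hn2E hipF) normc_real ger0_norm ?sqr_ge0.
  rewrite {2}/X (ip_sumr hipF).
  apply: le_trans (normc_sum M (fun j => ipF X (a (J (g j)) (a (h j) P)))) _.
  apply: ler_sum => j _; rewrite -ad_adj //; last exact: D_a.
  exact: cauchy_schwarz.
have A2 : \sum_(j < M) A j ^+ 2 <= (c2 * n%:R + \sum_(j < M) hnL (g j) ^+ 2) * hn X ^+ 2.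
  rewrite mulrDl mulr_suml; under eq_bigr => j _ do rewrite /A ad_norm //.
  by rewrite big_split /= lerD2r; apply: sum_a_bound.
have B2 : \sum_(j < M) B j ^+ 2 <= n.+2%:R * hn P ^+ 2.
  have := sum_a_bound (g := fun j => J (h j)) (M := M) hP ler01.
  rewrite mul1r; under eq_bigr => j _ do rewrite (conjK hJ).
  by apply => x; rewrite mul1r.
have [X0|X0] := eqVneq (hn X) 0.
  rewrite X0 expr2 mulr0; apply: mulr_ge0 (sqr_ge0 _); apply: mulr_ge0 (ler0n _ _).
  by apply: addr_ge0; [rewrite mulr_ge0|apply: sumr_ge0 => j _; rewrite sqr_ge0].
have hX : 0 < hn X ^+ 2 by apply: exprn_gt0; rewrite lt_def X0 hn_ge0.
set K := c2 * n%:R + _ in A2 *.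
rewrite -(ler_pM2r hX).
apply: le_trans (_ : (\sum_(j < M) A j * B j) ^+ 2 <= _).
  by rewrite -expr2 lerXn2r ?nnegrE ?sqr_ge0 // (le_trans _ XE) ?sqr_ge0.
apply: le_trans (_ : (\sum_(j < M) A j ^+ 2) * (\sum_(j < M) B j ^+ 2) <= _).
  exact: sum_cauchy_schwarz.
apply: le_trans (ler_pM _ _ A2 B2) _; try by apply: sumr_ge0 => j _; rewrite sqr_ge0.
by rewrite le_eqVlt; apply/orP; left; apply/eqP; ring.
Qed.

End FockAlgebra.

(** * Particle number sectors *)

Section Closure.
Context {R : realType} {V : lmodType R[i]} {ip : V -> V -> R[i]}.
Hypothesis hip : inner_product ip.
Local Notation hn := (hnorm ip).
Local Notation hcvg := (hcvg ip).

Lemma hclosure_seq S x : hclosure ip S x -> exists u, (forall n, S (u n)) /\ hcvg u x.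
Proof.
move=> h.
have /choice[u hu] : forall n : nat, exists y, S y /\ hn (x - y) < n.+1%:R^-1.
  by move=> n; apply: h; rewrite invr_gt0 ltr0n.
exists u; split=> [n|]; first by case: (hu n).
apply: (hcvg_squeeze (r := fun n => n.+1%:R^-1)) => [n|]; last exact: cvg_harmonic.
by rewrite (hnBC hip); case: (hu n) => _ /ltW.
Qed.

Lemma hcvg_hclosure S u x : (forall n, S (u n)) -> hcvg u x -> hclosure ip S x.
Proof.
move=> hu /hcvgP h e /h [N hN]; exists (u N); split=> //.
by rewrite (hnBC hip); apply: hN.
Qed.

Lemma hclosure_lin S c x y : hclosure ip (hspan S) x -> hclosure ip (hspan S) y ->
  hclosure ip (hspan S) (c *: x + y).
Proof.
move=> /hclosure_seq [u [Su hu]] /hclosure_seq [v [Sv hv]].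
apply: (hcvg_hclosure (u := fun n => c *: u n + v n)); first by move=> n; apply: hspan_lin.
exact: (hcvgD hip (hcvgZ hip c hu) hv).
Qed.

Lemma hclosure_sub S x : S x -> hclosure ip S x.
Proof. by move=> Sx; apply: (hcvg_hclosure (u := fun=> x)) => //; apply: hcvg_cst. Qed.

Lemma ip_hclosure_eq S z w y : (forall x, S x -> ip x z = ip x w) ->
  hclosure ip S y -> ip y z = ip y w.
Proof.
move=> h /hclosure_seq [u [Su hu]].
apply: (hcvg_ip_eq hip hip hu (hcvg_cst hip z) hu (hcvg_cst hip w)) => n; exact: h.
Qed.

Lemma ip_hclosure_le S z y K : 0 <= K -> (forall x, S x -> normc (ip x z) <= K * hn x) ->
  hclosure ip S y -> normc (ip y z) <= K * hn y.
Proof.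
move=> K0 h /hclosure_seq [u [Su hu]]; apply/ler_addgt0Pl => e e0.
have e1 : 0 < e / (K + 1) by rewrite divr_gt0 // ltr_wpDl.
have [N1 h1] := hcvg_ip hip hu (hcvg_cst hip z) e1.
have [N2 h2] := (hcvgP _ _).1 hu _ e1.
have := h1 (maxn N1 N2) (leq_maxl _ _); have := h2 (maxn N1 N2) (leq_maxr _ _).
move: (maxn N1 N2) => n; rewrite -normcN opprB => k1 k2.
have k3 := h _ (Su n).
have k4 : normc (ip y z) <= normc (ip y z - ip (u n) z) + normc (ip (u n) z).
  by apply: le_trans (le_normcD _ _); rewrite subrK.
have k5 : hn (u n) <= hn (u n - y) + hn y.
  by apply: le_trans (hnD hip _ _); rewrite subrK.
have k6 : e / (K + 1) * (K + 1) = e by rewrite divfK // gt_eqF // ltr_wpDl.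
nra.
Qed.

End Closure.

Section Sectors.
Context {R : realType} {L F : lmodType R[i]}.
Context {ipL : L -> L -> R[i]} {J : L -> L} {ipF : F -> F -> R[i]}.
Context {a ad : L -> F -> F} {D : set F} {Om : F}.
Hypothesis hipL : inner_product ipL.
Hypothesis hJ : conjugation ipL J.
Hypothesis hilbF : hilbert ipF.
Hypothesis hF : fock_rep ipL J ipF a ad D Om.
Let hipF : inner_product ipF := hilbF.1.
Local Notation hn := (hnorm ipF).
Local Notation S := (hspan (all_cvecs ad Om)).
Local Notation Sn n := (hspan (n_cvecs ad Om n)).
Local Notation Fn := (Fn ipF ad Om).
Local Notation comp := (Defs.comp ipF ad Om).
Local Notation hcvg := (hcvg ipF).

Lemma S_seq P : exists u, (forall k, S (u k)) /\ hcvg u P.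
Proof. by apply: (hclosure_seq hipF); rewrite (S_dense hF). Qed.

Lemma ip_Sn_sum n z (N : nat) (p : nat -> F) : Sn n z -> (forall m, Sn m (p m)) ->
  (forall m, (N <= m)%N -> p m = 0) -> ipF z (\sum_(m < N) p m) = ipF z (p n).
Proof.
move=> hz hp p0; rewrite (ip_sumr hipF); have [nN|Nn] := ltnP n N; last first.
  rewrite (p0 _ Nn) big1 ?(ip0r hipF) // => -[m mN] _ /=.
  by apply: (Sn_orth hJ hipF hF hz (hp m)) => e; move: mN; rewrite -e ltnNge Nn.
rewrite (bigD1 (Ordinal nN)) //= big1 ?addr0 // => m /eqP mn.
by apply: (Sn_orth hJ hipF hF hz (hp m)) => e; apply: mn; apply: val_inj.
Qed.

(* The component in [Fn n] is the limit of the components of approximants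
   from the algebraic span, so that no projection theorem is needed. *)
Lemma comp_ex n P : exists y, Fn n y /\ forall z, Fn n z -> ipF z (P - y) = 0.
Proof.
have [u [Su hu]] := S_seq P.
have /choice[f hf] : forall k, exists Np : nat * (nat -> F),
    [/\ (forall m, Sn m (Np.2 m)), (forall m, (Np.1 <= m)%N -> Np.2 m = 0) &
      u k = \sum_(m < Np.1) Np.2 m].
  by move=> k; have [N [p h]] := S_decomp (Su k); exists (N, p).
pose v k := (f k).2 n.
have Sv k : Sn n (v k) by case: (hf k).
have ipv k z : Sn n z -> ipF z (u k) = ipF z (v k).
  by move=> hz; case: (hf k) => h1 h2 ->; apply: ip_Sn_sum.
have le_v k l : hn (v k - v l) <= hn (u k - u l).
  have hw : Sn n (v k - v l) by apply: hspanB.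
  apply: sqr_le_mul_le; [exact: hn_ge0|exact: hn_ge0|].
  rewrite mulrC; apply: le_trans (cauchy_schwarz hipF _ _).
  by rewrite (ipBr hipF) !ipv // -(ipBr hipF) -(hn2E hipF) normc_real ler_norm.
have [|y hy] := hilbF.2 v.
  move=> e e0; have [N hN] := hcvg_cauchy hipF hu e0; exists N => k l Nk Nl.
  exact: le_lt_trans (le_v k l) (hN _ _ Nk Nl).
exists y; split; first exact: (hcvg_hclosure hipF Sv hy).
move=> z hz; rewrite (ipBr hipF); apply/eqP; rewrite subr_eq0; apply/eqP.
apply: (ip_hclosure_eq hipF _ hz) => x hx.
apply: (hcvg_ip_eq hipF hipF (hcvg_cst hipF x) hu (hcvg_cst hipF x) hy) => k.
exact: ipv.
Qed.

Lemma compP n P : Fn n (comp n P) /\ forall z, Fn n z -> ipF z (P - comp n P) = 0.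
Proof.
exact: (epsilon_spec (inhabits 0)
  (fun y => Fn n y /\ forall z, Fn n z -> ipF z (P - y) = 0) (comp_ex n P)).
Qed.

Lemma Fn_comp n P : Fn n (comp n P). Proof. by case: (compP n P). Qed.

Lemma comp_ip n P z : Fn n z -> ipF z P = ipF z (comp n P).
Proof.
by case: (compP n P) => _ h /h /eqP; rewrite (ipBr hipF) subr_eq0 => /eqP.
Qed.

Lemma Sn_Fn n P : Sn n P -> Fn n P. Proof. exact: hclosure_sub. Qed.

Lemma Fn_lin n c x y : Fn n x -> Fn n y -> Fn n (c *: x + y).
Proof. exact: hclosure_lin. Qed.

(** The difference of the two candidates lies in [Fn n] and is orthogonal to it. This is how
    components are computed from tests on the algebraic sector. *)
Lemma comp_unique n P y : Fn n y -> (forall z, Sn n z -> ipF z P = ipF z y) -> comp n P = y.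
Proof.
move=> hy h; apply/eqP; rewrite -subr_eq0; apply/eqP/(hn0_eq hipF).
have hw : Fn n (comp n P - y).
  by rewrite addrC -scaleN1r; apply: Fn_lin => //; apply: Fn_comp.
rewrite /hnorm (ipBr hipF) -(comp_ip _ hw).
by rewrite (ip_hclosure_eq hipF h hw) subrr sqrtr0.
Qed.

Lemma comp_lin n (c : R[i]) P Q : comp n (c *: P + Q) = c *: comp n P + comp n Q.
Proof.
apply: comp_unique => [|z /Sn_Fn hz]; first by apply: Fn_lin; apply: Fn_comp.
by rewrite !(ipDr hipF) !(ipZr hipF) (comp_ip P hz) (comp_ip Q hz).
Qed.

Lemma comp_sum n N (p : nat -> F) : (forall m, Sn m (p m)) ->
  (forall m, (N <= m)%N -> p m = 0) -> comp n (\sum_(m < N) p m) = p n.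
Proof.
move=> hp p0; apply: comp_unique => [|z hz]; first exact: Sn_Fn.
exact: ip_Sn_sum.
Qed.

Lemma Fn_orth n m x y : Fn n x -> Fn m y -> n <> m -> ipF x y = 0.
Proof.
move=> hx hy nm; rewrite -(ip0r hipF x); apply: (ip_hclosure_eq hipF _ hx) => w hw.
rewrite (ip0r hipF) (ipC hipF) -[0]conjC0; congr (_^*); rewrite -(ip0r hipF y).
apply: (ip_hclosure_eq hipF _ hy) => v hv; rewrite (ip0r hipF).
by apply: (Sn_orth hJ hipF hF hv hw) => e; apply: nm.
Qed.

Definition trunc N P := \sum_(n < N) comp n P.

Lemma hn2_sum_Fn N (p : nat -> F) : (forall n, Fn n (p n)) ->
  hn (\sum_(n < N) p n) ^+ 2 = \sum_(n < N) hn (p n) ^+ 2.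
Proof.
move=> hp; apply: (hn2_sum_orth hipF) => i j _ _ /eqP ij; exact: Fn_orth.
Qed.

Lemma ip_sub_trunc N P (p : nat -> F) : (forall n, Fn n (p n)) ->
  ipF (\sum_(n < N) p n) (P - trunc N P) = 0.
Proof.
move=> hp; rewrite (ip_suml hipF) big1 // => -[n nN] _ /=.
rewrite (ipBr hipF) (comp_ip P (hp n)) (ip_sumr hipF) (bigD1 (Ordinal nN)) //=.
rewrite big1 ?addr0 ?subrr // => m /eqP mn.
apply: (Fn_orth (hp n) (Fn_comp m P)) => e; apply: mn; exact: val_inj.
Qed.

(** Truncation is the best approximation from the first [N] sectors, hence at least as good as any
    approximant from [S], which occupies finitely many sectors. *)
Lemma trunc_cvg P : hcvg (fun N => trunc N P) P.
Proof.
apply/hcvgP => e e0; have [u [Su hu]] := S_seq P.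
have [k /(_ _ (leqnn k)) hk] := (hcvgP _ _).1 hu _ e0.
have [M [p [hp p0 uE]]] := S_decomp (Su k).
exists M => N MN; apply: le_lt_trans hk.
have uN : u k = \sum_(n < N) p n.
  rewrite uE -(subnK MN) addnC big_split_ord /= [X in _ = _ + X]big1 ?addr0 // => i _.
  by rewrite p0 ?leq_addr.
rewrite (hnBC hipF) (hnBC hipF (u k)) -(@ler_pXn2r _ 2) ?nnegrE ?hn_ge0 //.
have -> : P - u k = \sum_(n < N) (comp n P - p n) + (P - trunc N P).
  by rewrite sumrB -uN addrCA addrAC subrr add0r.
rewrite [X in _ <= X](hn2_orth hipF) ?lerDr ?sqr_ge0 //.
apply: (@ip_sub_trunc N P (fun n => comp n P - p n)) => n; rewrite addrC -scaleN1r.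
by apply: Fn_lin; [apply: Sn_Fn|apply: Fn_comp].
Qed.

Lemma hn2_le_sum_comp P (B : R) : (forall N, \sum_(n < N) hn (comp n P) ^+ 2 <= B) ->
  hn P ^+ 2 <= B.
Proof.
move=> h.
have B0 : 0 <= B by have := h 0%N; rewrite big_ord0.
have : hn P <= Num.sqrt B.
  apply: (hcvg_hn_le hipF (trunc_cvg P)); exists 0%N => n _.
  rewrite -(@ler_pXn2r _ 2) ?nnegrE ?hn_ge0 ?sqrtr_ge0 // (sqr_sqrtr B0).
  by have -> : hn (trunc n P) ^+ 2 = _ := hn2_sum_Fn n (fun m => Fn_comp m P).
by rewrite -(@ler_pXn2r _ 2) ?nnegrE ?hn_ge0 ?sqrtr_ge0 // (sqr_sqrtr B0).
Qed.

(** The hypothesis extends to the closure [Fn m], where it can be tested at [comp m z] itself. *)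
Lemma comp_le_of_weak m z (K : R) : 0 <= K ->
  (forall Psi, Sn m Psi -> normc (ipF Psi z) ^+ 2 <= K * hn Psi ^+ 2) ->
  hn (comp m z) ^+ 2 <= K.
Proof.
move=> K0 h.
have h' Psi : Fn m Psi -> normc (ipF Psi z) <= Num.sqrt K * hn Psi.
  apply: (ip_hclosure_le hipF) => [|x /h]; first exact: sqrtr_ge0.
  rewrite -[in X in _ <= X -> _](sqr_sqrtr K0) -exprMn.
  by rewrite ler_pXn2r ?nnegrE ?mulr_ge0 ?sqrtr_ge0 ?normc_ge0 ?hn_ge0.
have := h' _ (Fn_comp m z); rewrite (comp_ip z (Fn_comp m z)).
rewrite -(hn2E hipF) normc_real ger0_norm ?sqr_ge0 // => /sqr_le_mul_le.
move=> /(_ (sqrtr_ge0 _) (hn_ge0 _)).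
by rewrite -(@ler_pXn2r _ 2) ?nnegrE ?hn_ge0 ?sqrtr_ge0 // (sqr_sqrtr K0).
Qed.

(** For nonnegative weights this is a bound on the weighted sum [wsum], expressed by partial sums in
    order to stay in the reals; [wsum_le] is the translation. *)
Definition wle (w : nat -> R) P (B : R) : Prop :=
  forall N, \sum_(n < N) w n * hn (comp n P) ^+ 2 <= B.

Lemma wle_mono (w v : nat -> R) P B : (forall n, w n <= v n) -> wle v P B -> wle w P B.
Proof.
by move=> wv h N; apply: le_trans (h N); apply: ler_sum => n _; rewrite ler_wpM2r ?sqr_ge0.
Qed.

Lemma wle_scale (w : nat -> R) (c : R) P B : 0 <= c -> wle w P B -> wle (fun n => c * w n) P (c * B).
Proof.
move=> c0 h N; under eq_bigr => n _ do rewrite -mulrA.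
by rewrite -mulr_sumr ler_wpM2l.
Qed.

Lemma wle_norm P B : wle (fun=> 1) P B -> hn P ^+ 2 <= B.
Proof. by move=> h; apply: hn2_le_sum_comp => N; have := h N; under eq_bigr => n _ do rewrite mul1r. Qed.

Lemma comp_B n P Q : comp n (P - Q) = comp n P - comp n Q.
Proof. by have := comp_lin n (-1) Q P; rewrite !scaleN1r !(addrC (- _)). Qed.

Lemma wle_B (w : nat -> R) P Q A B : (forall n, 0 <= w n) -> wle w P A -> wle w Q B ->
  wle w (P - Q) (2 * A + 2 * B).
Proof.
move=> w0 h k N.
apply: le_trans (_ : 2 * (\sum_(n < N) w n * hn (comp n P) ^+ 2) +
   2 * (\sum_(n < N) w n * hn (comp n Q) ^+ 2) <= _); last first.
  by have := h N; have := k N; lra.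
rewrite !mulr_sumr -big_split /=; apply: ler_sum => n _.
rewrite comp_B; have := hnD hipF (comp n P) (- comp n Q); rewrite (hnN hipF).
move: (hn_ge0 (ip := ipF) (comp n P - comp n Q)) (hn_ge0 (ip := ipF) (comp n P)) (hn_ge0 (ip := ipF) (comp n Q)).
set x := hn (_ - _); set y := hn (comp n P); set z := hn (comp n Q) => x0 y0 z0 xyz.
have : x ^+ 2 <= 2 * y ^+ 2 + 2 * z ^+ 2.
  have h1 : x ^+ 2 <= (y + z) ^+ 2 by rewrite lerXn2r ?nnegrE ?addr_ge0.
  by have := sqr_ge0 (y - z); nra.
have -> : 2 * (w n * y ^+ 2) + 2 * (w n * z ^+ 2) = w n * (2 * y ^+ 2 + 2 * z ^+ 2) by ring.
by move=> h2; apply: ler_wpM2l.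
Qed.

(** For a [z] obtained from [P] by an operator that adds [s] particles: its first [s] components
    vanish, and the component [s + m] is controlled by the component [m] of [P]. *)
Lemma wle_raise s (w b : nat -> R) z P B : (forall n, 0 <= b n) ->
  (forall m Psi, (m < s)%N -> Sn m Psi -> ipF Psi z = 0) ->
  (forall m Psi, Sn (s + m) Psi ->
     normc (ipF Psi z) ^+ 2 <= b m * hn (comp m P) ^+ 2 * hn Psi ^+ 2) ->
  (forall n, 0 <= w n) -> wle (fun n => w (s + n)%N * b n) P B -> wle w z B.
Proof.
move=> b0 h0 h w0 hB N.
have c0 m : (m < s)%N -> comp m z = 0.
  move=> ms; apply: comp_unique => [|Psi hPsi]; first by apply: Sn_Fn; apply: hspan0.
  by rewrite (h0 m) // (ip0r hipF).
apply: le_trans (_ : \sum_(n < s + N) w n * hn (comp n z) ^+ 2 <= _).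
  apply: (ge0_sumr_ltn (f := fun n => w n * hn (comp n z) ^+ 2)) (leq_addl _ _).
  by move=> k; rewrite mulr_ge0 ?sqr_ge0.
rewrite big_split_ord /= big1 ?add0r => [|i _]; last by rewrite c0 // (hn0 hipF) expr0n mulr0.
apply: le_trans (hB N); apply: ler_sum => n _; rewrite -mulrA ler_wpM2l //.
by apply: comp_le_of_weak; [rewrite mulr_ge0 ?sqr_ge0|exact: h].
Qed.

(** The counterpart for removing [s] particles: the first [s] components of [P] are discarded. *)
Lemma wle_lower s (w v b : nat -> R) z P B : (forall n, 0 <= b n) ->
  (forall m Psi, Sn m Psi ->
     normc (ipF Psi z) ^+ 2 <= b m * hn (comp (s + m) P) ^+ 2 * hn Psi ^+ 2) ->
  (forall n, 0 <= w n) -> (forall n, 0 <= v n) -> (forall n, w n * b n <= v (s + n)%N) ->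
  wle v P B -> wle w z B.
Proof.
move=> b0 h w0 v0 wv hB N.
apply: le_trans (hB (s + N)%N); rewrite big_split_ord /=.
apply: le_trans (_ : \sum_(n < N) v (s + n)%N * hn (comp (s + n) P) ^+ 2 <= _); last first.
  by rewrite lerDr sumr_ge0 // => i _; rewrite mulr_ge0 ?sqr_ge0.
apply: ler_sum => n _; apply: le_trans (ler_wpM2r (sqr_ge0 _) (wv n)).
rewrite -mulrA ler_wpM2l //.
by apply: comp_le_of_weak; [rewrite mulr_ge0 ?sqr_ge0|exact: h].
Qed.

(** Supplies the pairing hypothesis of the two preceding transfer lemmas. [T] is the formal adjoint
    applied to [Psi]; lying in one sector, it sees only that component of [P]. *)
Lemma weak_sector_bound k z P Psi (T : F) b : Sn k T -> ipF Psi z = ipF T P ->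
  hn T ^+ 2 <= b * hn Psi ^+ 2 ->
  normc (ipF Psi z) ^+ 2 <= b * hn (comp k P) ^+ 2 * hn Psi ^+ 2.
Proof.
move=> hT -> hb; rewrite (comp_ip P (Sn_Fn hT)) mulrAC.
apply: le_trans (ler_wpM2r (sqr_ge0 _) hb); rewrite -exprMn.
by rewrite lerXn2r ?nnegrE ?mulr_ge0 ?normc_ge0 ?hn_ge0 // (cauchy_schwarz hipF).
Qed.

Lemma wle_approx (w : nat -> R) P B : (forall n, 0 <= w n) -> wle w P B ->
  forall eps, 0 < eps -> exists x, S x /\ wle w (x - P) eps.
Proof.
move=> w0 hB e e0.
have [N hN] : exists N, forall m n, (N <= m)%N -> (m <= n)%N ->
    \sum_(i < n) w i * hn (comp i P) ^+ 2 - \sum_(i < m) w i * hn (comp i P) ^+ 2 < e / 2.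
  apply: nondecr_bounded_tail hB _ _; last by rewrite divr_gt0.
  move=> m n; apply: (ge0_sumr_ltn (f := fun i => w i * hn (comp i P) ^+ 2)) => k.
  by rewrite mulr_ge0 ?sqr_ge0.
(* Half of [e] pays for the tail beyond [N], the other half is shared by the first [N] sectors; the
   denominator [N.+1] also covers [N = 0]. *)
have /choice[q hq] : forall n, exists y, Sn n y /\
    w n * hn (y - comp n P) ^+ 2 <= e / 2 / N.+1%:R.
  move=> n; set d := e / 2 / N.+1%:R.
  have d0 : 0 < d by rewrite !divr_gt0.
  have d1 : 0 < Num.sqrt (d / (w n + 1)) by rewrite sqrtr_gt0 divr_gt0 // ltr_wpDl.
  have [y [Sy hy]] := Fn_comp n P d1; exists y; split=> //.
  rewrite (hnBC hipF).
  have : hn (comp n P - y) ^+ 2 <= d / (w n + 1).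
    rewrite -[X in _ <= X]sqr_sqrtr; last by rewrite divr_ge0 ?ltW // ltr_wpDl.
    by rewrite lerXn2r ?nnegrE ?hn_ge0 ?sqrtr_ge0 // ltW.
  rewrite ler_pdivlMr ?ltr_wpDl //; have := w0 n; have := sqr_ge0 (hn (comp n P - y)); nra.
pose p n := if (n < N)%N then q n else 0.
have hp n : Sn n (p n) by rewrite /p; case: ifP => _; [case: (hq n)|exact: hspan0].
have p0 n : (N <= n)%N -> p n = 0 by rewrite /p leqNgt => /negbTE ->.
exists (\sum_(n < N) p n); split.
  by apply: (hspan_sum (f := p)) => i _; apply: Sn_S (hp i).
move=> M.
apply: le_trans (_ : \sum_(n < N + M) w n * hn (p n - comp n P) ^+ 2 <= _).
  under eq_bigr => n _ do rewrite comp_B comp_sum //.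
  apply: (ge0_sumr_ltn (f := fun n => w n * hn (p n - comp n P) ^+ 2)) (leq_addl _ _).
  by move=> k; rewrite mulr_ge0 ?sqr_ge0.
rewrite big_split_ord /= [e]splitr; apply: lerD.
  apply: le_trans (_ : \sum_(n < N) e / 2 / N.+1%:R <= _).
    by apply: ler_sum => n _; rewrite /p ltn_ord; case: (hq n).
  rewrite sumr_const card_ord -[X in X <= _]mulr_natr -mulrA ger_pMr ?divr_gt0 //.
  by rewrite mulrC ler_pdivrMr // mul1r ler_nat.
have := ltW (hN N (N + M)%N (leqnn _) (leq_addr _ _)).
rewrite big_split_ord /= [X in X <= _ -> _]addrC addKr; apply: le_trans; apply: ler_sum => n _.
by rewrite p0 ?leq_addr // sub0r (hnN hipF).
Qed.

Local Notation wsum := (wsum ipF ad Om).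

Lemma S_wle (w : nat -> R) P : (forall n, 0 <= w n) -> S P -> exists B, wle w P B.
Proof.
move=> w0 /S_decomp [N [p [hp p0 ->]]].
exists (\sum_(n < N) w n * hn (p n) ^+ 2) => M.
apply: le_trans (_ : \sum_(n < N + M) w n * hn (p n) ^+ 2 <= _).
  under eq_bigr => n _ do rewrite comp_sum //.
  apply: (ge0_sumr_ltn (f := fun n => w n * hn (p n) ^+ 2)) (leq_addl _ _).
  by move=> k; rewrite mulr_ge0 ?sqr_ge0.
rewrite big_split_ord /= [X in _ + X]big1 ?addr0 // => n _.
by rewrite p0 ?leq_addr // (hn0 hipF) expr0n mulr0.
Qed.

Lemma weak_unique z z' : (forall Psi, S Psi -> ipF Psi z = ipF Psi z') -> z = z'.
Proof.
move=> h; apply: (ip_ext hilbF) => x; apply: (ip_hclosure_eq hipF h).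
by rewrite (S_dense hF).
Qed.

(** The bound [B] only ensures that the limit defining [mulop] exists. Each partial sum T satisfies
    (T, T) = (T, z) with the limit z, since the later sectors are orthogonal to T; Cauchy-Schwarz
    then gives |T| <= |z|. *)
Lemma mulop_ge (w : nat -> R) P B : wle (fun n => w n ^+ 2) P B ->
  wle (fun n => w n ^+ 2) P (hn (mulop ipF ad Om w P) ^+ 2).
Proof.
move=> hB; pose p n := (w n)%:C%C *: comp n P.
have FpZ c n : Fn n (c *: comp n P).
  have F0 : Fn n 0 by apply: Sn_Fn; apply: hspan0.
  by rewrite -[_ *: _]addr0; apply: Fn_lin => //; apply: Fn_comp.
have Fp n : Fn n (p n) by apply: FpZ.
have hn2p n : hn (p n) ^+ 2 = w n ^+ 2 * hn (comp n P) ^+ 2.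
  by rewrite (hnZ hipF) exprMn normc_real real_normK ?num_real.
have [z hz] : exists z, hcvg (fun M => \sum_(n < M) p n) z.
  apply: hilbF.2; apply: (hcauchy_dominated hipF (A := 1) (B := B)
      (s := fun M => \sum_(n < M) w n ^+ 2 * hn (comp n P) ^+ 2)) => //.
    move=> m n; apply: (ge0_sumr_ltn (f := fun n => w n ^+ 2 * hn (comp n P) ^+ 2)) => k.
    by rewrite mulr_ge0 ?sqr_ge0.
  move=> m n mn; rewrite mul1r -(subnK mn) [(n - m + m)%N]addnC !big_split_ord /=.
  rewrite [X in hn X]addrC addKr [X in _ <= X]addrC addKr.
  rewrite (hn2_sum_orth hipF (f := fun i => p (m + i)%N)); last first.
    by move=> i j _ _ /eqP ij; apply: (Fn_orth (Fp _) (Fp _)) => /addnI.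
  by apply: ler_sum => i _; rewrite hn2p.
have -> : mulop ipF ad Om w P = z.
  apply: (hcvg_unique hipF _ hz); exact: (epsilon_spec (inhabits 0)
    (fun z => hcvg (fun M => \sum_(n < M) (w n)%:C%C *: comp n P) z) (ex_intro _ z hz)).
move=> N; set T := \sum_(n < N) p n.
have -> : \sum_(n < N) w n ^+ 2 * hn (comp n P) ^+ 2 = hn T ^+ 2.
  by rewrite (hn2_sum_Fn N Fp); apply: eq_bigr => n _; rewrite hn2p.
have TT : ipF T T = ipF T z.
  have hz' : hcvg (fun k => \sum_(n < N + k) p n) z.
    apply/hcvgP => e /((hcvgP _ _).1 hz) [K hK]; exists K => n /leq_trans Kn.
    by apply: hK; apply: Kn; apply: leq_addl.
  apply: (hcvg_ip_eq hipF hipF (hcvg_cst hipF T) (hcvg_cst hipF T) (hcvg_cst hipF T) hz') => k.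
  rewrite big_split_ord /= (ipDr hipF) [X in _ + X](ip_sumr hipF) [X in _ + X]big1 ?addr0 // => i _.
  rewrite (ip_suml hipF) big1 // => j _; apply: (Fn_orth (Fp _) (Fp _)) => e.
  by have := ltn_ord j; rewrite e ltnNge leq_addr.
rewrite ler_pXn2r ?nnegrE ?hn_ge0 //.
apply: sqr_le_mul_le; [exact: hn_ge0|exact: hn_ge0|].
rewrite mulrC; apply: le_trans (cauchy_schwarz hipF _ _).
by rewrite -TT -(hn2E hipF) normc_real ler_norm.
Qed.

Lemma wsum_le (w : nat -> R) P B : (forall n, 0 <= w n) ->
  (wsum w P <= B%:E)%E <-> wle w P B.
Proof.
move=> w0.
have t0 n : (0 <= (w n * hn (comp n P) ^+ 2)%:E)%E by rewrite lee_fin mulr_ge0 ?sqr_ge0.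
split=> [h N|h].
  rewrite -lee_fin; apply: le_trans h; rewrite -(big_mkord xpredT (fun n => w n * hn (comp n P) ^+ 2)).
  rewrite -sumEFin; apply: nneseries_lim_ge => n _ _; exact: t0.
apply: lime_le; first by apply: is_cvg_nneseries => n _ _; exact: t0.
apply: nearW => N; rewrite sumEFin lee_fin big_mkord; exact: h.
Qed.

Lemma wsum_ge0 (w : nat -> R) P : (forall n, 0 <= w n) -> (0 <= wsum w P)%E.
Proof.
by move=> w0; apply: nneseries_ge0 => n _ _; rewrite lee_fin mulr_ge0 ?sqr_ge0.
Qed.

Lemma wsum_lty (w : nat -> R) P : (forall n, 0 <= w n) ->
  (wsum w P < +oo)%E <-> exists B, wle w P B.
Proof.
move=> w0; have := wsum_ge0 P w0; split=> [h|[B /(wsum_le _ _ w0) h]]; last first.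
  exact: le_lt_trans h (ltry _).
exists (fine (wsum w P)); apply/(wsum_le _ _ w0); rewrite fineK //.
by rewrite ge0_fin_numE.
Qed.

Lemma wsum_cvg0 (w : nat -> R) (Q : nat -> F) : (forall n, 0 <= w n) ->
  (fun k => wsum w (Q k)) @ \oo --> 0%E <->
  forall eps, 0 < eps -> exists K, forall k, (K <= k)%N -> wle w (Q k) eps.
Proof.
move=> w0; split=> [h e e0|h].
  have /fine_cvgP[[K1 _ h1] /cvgrPdist_lt /(_ _ e0) [K2 _ h2]] := h.
  exists (maxn K1 K2) => k; rewrite geq_max => /andP[/h1 /= k1 /h2 /= k2].
  apply/(wsum_le _ _ w0); rewrite -(fineK k1) lee_fin.
  by move: k2; rewrite sub0r normrN => /ltW; apply: le_trans; rewrite ler_norm.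
apply/fine_cvgP; split.
  have [K hK] := h 1 ltr01; exists K => // k /hK /(wsum_le _ _ w0) /= hk.
  by rewrite ge0_fin_numE ?wsum_ge0 //; apply: le_lt_trans hk (ltry _).
apply/cvgrPdist_le => e /h [K hK]; exists K => // k /hK /(wsum_le _ _ w0) /= hk.
have f0 := wsum_ge0 (Q k) w0.
have fin : wsum w (Q k) \is a fin_num.
  by rewrite ge0_fin_numE //; apply: le_lt_trans hk (ltry _).
by rewrite sub0r normrN ger0_norm ?fine_ge0 // -lee_fin fineK.
Qed.

End Sectors.

(** * Extensions to D_{1/2} *)

Section Extensions.
Context {R : realType} {L F : lmodType R[i]}.
Context {ipL : L -> L -> R[i]} {J : L -> L} {ipF : F -> F -> R[i]}.
Context {a ad : L -> F -> F} {D : set F} {Om : F}.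
Hypothesis hipL : inner_product ipL.
Hypothesis hJ : conjugation ipL J.
Hypothesis hilbF : hilbert ipF.
Hypothesis hF : fock_rep ipL J ipF a ad D Om.
Let hipF : inner_product ipF := hilbF.1.
Local Notation hn := (hnorm ipF).
Local Notation hnL := (hnorm ipL).
Local Notation S := (hspan (all_cvecs ad Om)).
Local Notation Sn n := (hspan (n_cvecs ad Om n)).
Local Notation comp := (Defs.comp ipF ad Om).
Local Notation hcvg := (hcvg ipF).
Local Notation wle := (@wle R L F ipF ad Om).
Local Notation a_ext := (a_ext ipF a ad Om).
Local Notation ad_ext := (ad_ext ipF ad Om).

(** [w12] and [w1] are the weights that define D_{1/2} and D_1. *)
Definition w12 (n : nat) : R := n.+1%:R.
Definition w1 (n : nat) : R := n.+1%:R ^+ 2.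

Lemma w12_ge0 n : 0 <= w12 n. Proof. exact: ler0n. Qed.
Lemma w1_ge0 n : 0 <= w1 n. Proof. exact: sqr_ge0. Qed.
Lemma w12_ge1 n : 1 <= w12 n. Proof. by rewrite ler1n. Qed.
Lemma w12_le_w1 n : w12 n <= w1 n.
Proof. by rewrite /w1 expr2 ler_peMr ?w12_ge0 ?w12_ge1. Qed.

Lemma Dalpha1P P : Dalpha ipF ad Om 1 P <-> exists B, wle w1 P B.
Proof.
rewrite -(wsum_lty _ w1_ge0) /Dalpha /=.
suff -> : (fun n => n.+1%:R `^ (2 * 1)) = w1 by [].
by apply/funext => n; rewrite mulr1 powR_mulrn ?ler0n.
Qed.

Lemma wle_half P B : wle w1 P B -> wle w12 P B.
Proof. by apply: wle_mono => n; apply: w12_le_w1. Qed.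

Lemma wle_hn P B : wle w12 P B -> hn P ^+ 2 <= B.
Proof.
move=> h; apply: (wle_norm hJ hilbF hF).
by apply: wle_mono h => n; apply: w12_ge1.
Qed.

Lemma wle_approx_seq (w : nat -> R) P B : (forall n, 0 <= w n) -> wle w P B ->
  exists u : nat -> F, (forall k, S (u k)) /\ (forall k, wle w (u k - P) k.+1%:R^-1).
Proof.
move=> w0 hB.
have /choice[u hu] : forall k : nat, exists x, S x /\ wle w (x - P) k.+1%:R^-1.
  by move=> k; apply: (wle_approx hJ hilbF hF w0 hB); rewrite invr_gt0 ltr0n.
by exists u; split=> k; case: (hu k).
Qed.

Lemma wle12_hcvg (u : nat -> F) P :
  (forall eps, 0 < eps -> exists K, forall k, (K <= k)%N -> wle w12 (u k - P) eps) ->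
  hcvg u P.
Proof.
move=> h; apply/hcvgP => e e0.
have e2 : 0 < e ^+ 2 / 2 by rewrite divr_gt0 ?exprn_gt0.
have [K hK] := h _ e2; exists K => k /hK /wle_hn hk.
by apply: hn_lt_sqr => //; apply: le_lt_trans hk _; rewrite ltr_pdivrMr // ltr_pMr ?exprn_gt0 // ltr1n.
Qed.

Lemma inv_succ_small (e : R) : 0 < e -> exists K : nat, forall k, (K <= k)%N -> k.+1%:R^-1 < e.
Proof.
move=> e0; have /cvgrPdist_lt /(_ _ e0) [K _ hK] := @cvg_harmonic R.
exists K => k /hK /=; rewrite sub0r normrN ger0_norm //.
Qed.

Lemma wle_le (w : nat -> R) P A B : A <= B -> wle w P A -> wle w P B.
Proof. by move=> AB h N; apply: le_trans (h N) AB. Qed.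

(** Boundedness of [A] from the D_{1/2} norm to the norm of [F] makes the extension exist. Whichever
    approximating sequence stands behind the chosen value, the formal adjoint [T] fixes its
    pairings. *)
Lemma ext_weak (A T : F -> F) (K : R) P : 0 <= K ->
  (forall Q Q', S Q -> S Q' -> A (Q - Q') = A Q - A Q') ->
  (forall Q B, S Q -> wle w12 Q B -> hn (A Q) ^+ 2 <= K * B) ->
  (forall Psi Q, S Psi -> S Q -> ipF Psi (A Q) = ipF (T Psi) Q) ->
  (exists B, wle w12 P B) ->
  forall Psi, S Psi -> ipF Psi (ext ipF ad Om A P) = ipF (T Psi) P.
Proof.
move=> K0 AB Ab AT [B hB].
have [u [Su hu]] := wle_approx_seq w12_ge0 hB.
have [|z hz] := hilbF.2 (fun k => A (u k)).
  move=> e e0.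
  (* Two errors below [e^2 / (4 K + 1)], each doubled by [wle_B] and multiplied by [K], add up to
     less than [e^2]; the summand 1 covers [K = 0]. *)
  have e2 : 0 < e ^+ 2 / (4 * K + 1) by rewrite divr_gt0 ?exprn_gt0 // ltr_wpDl ?mulr_ge0.
  have [N hN] := inv_succ_small e2; exists N => k l /hN kN /hN lN.
  apply: hn_lt_sqr => //; rewrite -AB //.
  have h := wle_B hJ hilbF hF w12_ge0 (hu k) (hu l).
  have E : u k - P - (u l - P) = u k - u l by rewrite opprB addrA subrK.
  rewrite E in h; apply: le_lt_trans (Ab _ _ (hspanB (Su k) (Su l)) h) _.
  rewrite !ltr_pdivlMr ?ltr_wpDl ?mulr_ge0 // in kN lN.
  have k0 : (0 : R) <= k.+1%:R^-1 by rewrite invr_ge0.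
  have l0 : (0 : R) <= l.+1%:R^-1 by rewrite invr_ge0.
  have : k.+1%:R^-1 * (4 * K) <= k.+1%:R^-1 * (4 * K + 1) by rewrite ler_wpM2l // lerDl.
  have : l.+1%:R^-1 * (4 * K) <= l.+1%:R^-1 * (4 * K + 1) by rewrite ler_wpM2l // lerDl.
  move: kN lN; set x := k.+1%:R^-1; set y := l.+1%:R^-1; set p := x * _; set q := y * _.
  move=> h1 h2 h3 h4.
  have -> : K * (2 * x + 2 * y) = (y * (4 * K) + x * (4 * K)) / 2 by field.
  lra.
have hex : ext_rel ipF ad Om A P z.
  exists u; split=> //; apply/(wsum_cvg0 _ w12_ge0) => e /inv_succ_small [N hN].
  by exists N => k /hN /ltW kN; apply: wle_le kN (hu k).
have [v [Sv hv hAv]] := epsilon_spec (inhabits 0) (ext_rel ipF ad Om A P) (ex_intro _ z hex).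
move=> Psi SPsi.
have hvP : hcvg v P by apply: wle12_hcvg; apply/(wsum_cvg0 _ w12_ge0).
apply: (hcvg_ip_eq hipF hipF (hcvg_cst hipF Psi) hAv (hcvg_cst hipF (T Psi)) hvP) => k.
exact: AT.
Qed.

(** Treats [ad f] on [S] and [ad_ext f] on D_{1/2} alike: the norm bounds use this relation alone,
    so they serve first to construct the extension and then to estimate it. *)
Definition weak_ad f z P := forall Psi, S Psi -> ipF Psi z = ipF (a (J f) Psi) P.
Definition weak_a f z P := forall Psi, S Psi -> ipF Psi z = ipF (ad (J f) Psi) P.

Lemma weak_ad_wle f z P (w : nat -> R) B : weak_ad f z P -> (forall n, 0 <= w n) ->
  wle (fun n => w n.+1 * (hnL f ^+ 2 * n.+1%:R)) P B -> wle w z B.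
Proof.
move=> h w0; apply: (wle_raise hJ hilbF hF (s := 1) (b := fun n => hnL f ^+ 2 * n.+1%:R)) => //.
- by move=> n; rewrite mulr_ge0 ?sqr_ge0.
- move=> [|m] Psi // _ hPsi; rewrite h; last exact: Sn_S hPsi.
  by rewrite (a_S0 hF _ hPsi) (ip0l hipF).
move=> m Psi hPsi.
apply: (weak_sector_bound hJ hilbF hF (T := a (J f) Psi)); first exact: (a_Sn hF).
  by apply: h; exact: Sn_S hPsi.
by rewrite -(hn_conj hJ f); apply: (a_bound hipL hJ hipF hF).
Qed.

Lemma weak_a_wle f z P (w v : nat -> R) B : weak_a f z P -> (forall n, 0 <= w n) ->
  (forall n, 0 <= v n) -> (forall n, w n * (hnL f ^+ 2 * n.+1%:R) <= v n.+1) ->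
  wle v P B -> wle w z B.
Proof.
move=> h w0 v0 wv; apply: (wle_lower hJ hilbF hF (s := 1) (b := fun n => hnL f ^+ 2 * n.+1%:R)) => //.
  by move=> n; rewrite mulr_ge0 ?sqr_ge0.
move=> m Psi hPsi.
apply: (weak_sector_bound hJ hilbF hF (T := ad (J f) Psi)); first exact: (ad_Sn hF).
  by apply: h; exact: Sn_S hPsi.
by rewrite -(hn_conj hJ f); apply: (ad_bound hipL hJ hipF hF).
Qed.

Lemma ad_weak f Q : S Q -> weak_ad f (ad f Q) Q.
Proof.
move=> SQ Psi SPsi; rewrite (a_adj hF) ?(conjK hJ) //; exact: S_D hF _ _.
Qed.

Lemma a_weak f Q : S Q -> weak_a f (a f Q) Q.
Proof.
move=> SQ Psi SPsi; rewrite (ad_adj hJ hipF hF) ?(conjK hJ) //; exact: S_D hF _ _.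
Qed.

Lemma ad_ext_weak f P : (exists B, wle w12 P B) -> weak_ad f (ad_ext f P) P.
Proof.
apply: (ext_weak (T := a (J f)) (K := hnL f ^+ 2)); first exact: sqr_ge0.
- by move=> Q Q' SQ SQ'; apply: (adB hF); exact: S_D hF _ _.
- move=> Q B SQ hB; apply: (wle_norm hJ hilbF hF).
  apply: (weak_ad_wle (ad_weak f SQ)) => [n|//]; first exact: ler01.
  apply: wle_mono (wle_scale (sqr_ge0 (hnL f)) hB) => n; by rewrite mul1r.
- by move=> Psi Q SPsi SQ; apply: ad_weak.
Qed.

Lemma a_ext_weak f P : (exists B, wle w12 P B) -> weak_a f (a_ext f P) P.
Proof.
apply: (ext_weak (T := ad (J f)) (K := hnL f ^+ 2)); first exact: sqr_ge0.
- by move=> Q Q' SQ SQ'; apply: (aB hF); exact: S_D hF _ _.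
- move=> Q B SQ hB; apply: (wle_norm hJ hilbF hF).
  apply: (weak_a_wle (v := fun n => hnL f ^+ 2 * w12 n) (a_weak f SQ)) => [n|n|n|].
  + exact: ler01.
  + by rewrite mulr_ge0 ?sqr_ge0 ?w12_ge0.
  + by rewrite mul1r ler_wpM2l ?sqr_ge0 // ler_nat.
  exact: wle_scale (sqr_ge0 _) hB.
- by move=> Psi Q SPsi SQ; apply: a_weak.
Qed.

(** Creation maps D_1 into D_{1/2}, so that a second extended operator can be applied. The 2 comes
    from [(n+2) (n+1) <= 2 (n+1)^2]. *)
Lemma ad_ext_half f P : (exists B, wle w1 P B) -> exists B, wle w12 (ad_ext f P) B.
Proof.
move=> [B hB]; exists (2 * hnL f ^+ 2 * B).
apply: (weak_ad_wle (ad_ext_weak f (ex_intro _ B (wle_half hB))) w12_ge0).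
apply: wle_mono (wle_scale (_ : 0 <= 2 * hnL f ^+ 2) hB) => [n|]; last by rewrite mulr_ge0 ?sqr_ge0.
rewrite /w12 /w1 -[n.+2%:R]natr1.
have : (1 : R) <= n.+1%:R by rewrite ler1n.
have := sqr_ge0 (hnL f); set x := hnL f ^+ 2; set y := n.+1%:R => x0 y1.
have -> : (y + 1) * (x * y) = x * (y * (y + 1)) by ring.
have -> : 2 * x * y ^+ 2 = x * (y * (2 * y)) by ring.
by do 2?apply: ler_wpM2l => //; lra.
Qed.

Lemma a_ext_half f P : (exists B, wle w1 P B) -> exists B, wle w12 (a_ext f P) B.
Proof.
move=> [B hB]; exists (hnL f ^+ 2 * B).
apply: (weak_a_wle (v := fun n => hnL f ^+ 2 * w1 n)
  (a_ext_weak f (ex_intro _ B (wle_half hB))) w12_ge0) => [n|n|].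
- by rewrite mulr_ge0 ?sqr_ge0.
- rewrite /w12 /w1 mulrCA -expr2 ler_wpM2l ?sqr_ge0 //.
  by rewrite lerXn2r ?nnegrE ?ler0n // ler_nat.
exact: wle_scale (sqr_ge0 _) hB.
Qed.

Lemma ad_ext_S f Q : S Q -> ad_ext f Q = ad f Q.
Proof.
move=> SQ; apply: (weak_unique hilbF hF) => Psi SPsi.
rewrite (ad_ext_weak f _ SPsi) ?ad_weak //; exact: (S_wle hJ hilbF hF w12_ge0 SQ).
Qed.

End Extensions.

(** * Quadratic expressions *)

Section Quadratic.
Context {R : realType} {L F : lmodType R[i]}.
Context {ipL : L -> L -> R[i]} {J : L -> L} {ipF : F -> F -> R[i]}.
Context {a ad : L -> F -> F} {D : set F} {Om : F}.
Hypothesis hilbL : hilbert ipL.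
Hypothesis hJ : conjugation ipL J.
Hypothesis hilbF : hilbert ipF.
Hypothesis hF : fock_rep ipL J ipF a ad D Om.
Let hipL : inner_product ipL := hilbL.1.
Let hipF : inner_product ipF := hilbF.1.
Local Notation hn := (hnorm ipF).
Local Notation hnL := (hnorm ipL).
Local Notation S := (hspan (all_cvecs ad Om)).
Local Notation Sn n := (hspan (n_cvecs ad Om n)).
Local Notation comp := (Defs.comp ipF ad Om).
Local Notation hcvg := (hcvg ipF).
Local Notation hcvgL := (Defs.hcvg ipL).
Local Notation wle := (@wle R L F ipF ad Om).
Local Notation a_ext := (a_ext ipF a ad Om).
Local Notation ad_ext := (ad_ext ipF ad Om).
Local Notation DeltaplusM := (DeltaplusM J ipF ad Om).
Local Notation DeltaM := (DeltaM J ipF a ad Om).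

Lemma a_hcvg (f : nat -> L) g n P : Sn n P -> hcvgL f g ->
  hcvg (fun k => a (f k) P) (a g P).
Proof.
move=> hP hf; have dP := Sn_D hF hP.
apply: (hcvg_squeeze (r := fun k => hnL (f k - g) * (Num.sqrt n%:R * hn P))) => [k|].
  have -> : a (f k) P - a g P = a (f k - g) P.
    by rewrite -(linB (A := fun f => a f P)) //; exact: (a_linf hF dP).
  rewrite -(@ler_pXn2r _ 2) ?nnegrE ?mulr_ge0 ?hn_ge0 ?sqrtr_ge0 //.
  by rewrite !exprMn (sqr_sqrtr (ler0n _ _)) mulrA; apply: (a_bound hipL hJ hipF hF).
by rewrite -(mul0r (Num.sqrt n%:R * hn P)); apply: cvgM => //; exact: cvg_cst.
Qed.

(* The [n - 2] particle vectors, without truncated subtraction. *)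
Definition low2 (n : nat) (X : F) : Prop := if n is m.+2 then Sn m X else X = 0.

Lemma low2_0 n : low2 n 0.
Proof. by case: n => [//|[//|n]]; apply: hspan0. Qed.

Lemma low2_D n X Y : low2 n X -> low2 n Y -> low2 n (X + Y).
Proof. by case: n => [|[|n]] /=; try exact: hspanD; move=> -> ->; rewrite addr0. Qed.

Lemma low2_B n X Y : low2 n X -> low2 n Y -> low2 n (X - Y).
Proof. by case: n => [|[|n]] /=; try exact: hspanB; move=> -> ->; rewrite subr0. Qed.

Lemma low2_S n X : low2 n X -> S X.
Proof. by case: n => [|[|n]] /= => [->|->|/Sn_S //]; apply: hspan0. Qed.

Lemma low2_a n f P : Sn n P -> low2 n.+1 (a f P).
Proof. by case: n => [|n] hP /=; [exact: (a_S0 hF)|exact: (a_Sn hF)]. Qed.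

Lemma low2_aa n f g P : Sn n P -> low2 n (a f (a g P)).
Proof.
case: n => [|[|n]] hP /=; first by rewrite (a_S0 hF g hP) (a0 hF).
  by apply: (a_S0 hF); apply: (a_Sn hF).
by do 2!apply: (a_Sn hF).
Qed.

Lemma low2_ad n f X : low2 n X -> low2 n.+1 (ad f X).
Proof.
case: n => [|[|n]] /= => [->|->|]; [exact: (ad0 hF)|rewrite (ad0 hF); exact: hspan0|].
exact: (ad_Sn hF).
Qed.

Lemma low2_ad_bound n f X : low2 n X -> hn (ad f X) ^+ 2 <= hnL f ^+ 2 * n.+1%:R * hn X ^+ 2.
Proof.
case: n => [|[|n]] /=; try by move=> ->; rewrite (ad0 hF) (hn0 hipF) expr0n mulr0.
move=> hX; apply: le_trans (ad_bound hipL hJ hipF hF f hX) _.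
by rewrite ler_wpM2r ?sqr_ge0 // ler_wpM2l ?sqr_ge0 // ler_nat ltnS ltnW.
Qed.

(** The operator [B_M] of the overview, formal adjoint of [DeltaplusM C e M]. *)
Definition aaM (C : L -> L) (e : nat -> L) (M : nat) (Psi : F) : F :=
  \sum_(j < M) a (e j) (a (J (C (e j))) Psi).

(* Limit of [aaM C e M] on creation vectors, from the commutator of [aaM] with
   [ad f]; [A] stands for the adjoint of [C]. It is visibly invariant under
   exchanging [C] with its transpose, i.e. [A] with [fun f => J (C (J f))]. *)
Fixpoint aa_lim (C A : L -> L) (fs : seq L) : F :=
  if fs is f :: gs then
    ad f (aa_lim C A gs) + (a (A f) (cvec ad Om gs) + a (J (C (J f))) (cvec ad Om gs))
  else 0.

Lemma aa_lim_transp (C A C' A' : L -> L) fs : (forall f, A' f = J (C (J f))) ->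
  (forall f, J (C' (J f)) = A f) -> aa_lim C' A' fs = aa_lim C A fs.
Proof.
by move=> h1 h2; elim: fs => [//|f fs IH] /=; rewrite IH h1 h2 [X in _ + X = _]addrC.
Qed.

Lemma aa_lim_low2 C A fs : low2 (size fs) (aa_lim C A fs).
Proof.
elim: fs => [//|f fs IH]; apply: low2_D; first exact: low2_ad.
by apply: low2_D; apply: low2_a; apply: Sn_cvec.
Qed.

Lemma aaM_low2 C e M n P : Sn n P -> low2 n (aaM C e M P).
Proof.
by move=> hP; rewrite /aaM; elim/big_ind: _ => [|x y|i _]; [exact: low2_0|exact: low2_D|exact: low2_aa].
Qed.

Lemma aaM_lin C e M (c : R[i]) P Q : S P -> S Q ->
  aaM C e M (c *: P + Q) = c *: aaM C e M P + aaM C e M Q.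
Proof.
move=> /(S_D hF) dP /(S_D hF) dQ.
rewrite /aaM scaler_sumr -big_split /=; apply: eq_bigr => j _.
by rewrite !(a_lin hF) //; apply: (D_a hF).
Qed.

(** * Convergence and bounds for one operator with its adjoint *)

Section Operator.
Variables C A : L -> L.
Hypothesis hC : hilbert_schmidt ipL C.
Hypothesis hA : forall x y, ipL (C x) y = ipL x (A y).
Let linC := hC.1.1.

(** The two commutator terms contain the system only through partial expansions of [A f] and [J f];
    as these converge to [A f] and [J f], the limit forgets the system. *)
Lemma aaM_ad e M f P : S P ->
  aaM C e M (ad f P) = ad f (aaM C e M P) +
    (a (onproj ipL M e (A f)) P + a (J (C (onproj ipL M e (J f)))) P).
Proof.
move=> SP; have dP := S_D hF SP.
have linaP := a_linf hF dP.
rewrite /aaM (ad_sum hF f M (p := fun j => a (e j) (a (J (C (e j))) P))); last first.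
  by move=> j; do 2!apply: (D_a hF).
rewrite /onproj (lin_sum linaP M (fun i => ipL (e i) (A f) *: e i)).
rewrite (lin_sum linC M (fun i => ipL (e i) (J f) *: e i)).
rewrite (conj_sum hJ M (fun i => C (ipL (e i) (J f) *: e i))).
rewrite (lin_sum linaP M (fun i => J (C (ipL (e i) (J f) *: e i)))) -!big_split /=.
apply: eq_bigr => j _.
rewrite (a_ad hF _ _ dP) (conjK hJ) [ad f _ + _]addrC (a_lin hF) //; first last.
- by apply: (D_ad hF); apply: (D_a hF).
rewrite (a_ad hF); last exact: (D_a hF).
rewrite (linZ linaP) (linZ linC) (conjZ hJ) (linZ linaP) hA -(ipC hipL).
by rewrite -(conj_ipl hJ (e j) f) addrCA.
Qed.

Lemma aaM_cvec e fs : cons_ ipL e ->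
  hcvg (fun M => aaM C e M (cvec ad Om fs)) (aa_lim C A fs).
Proof.
move=> he; elim: fs => [|f fs IH].
  apply: hcvg_ext (hcvg_cst hipF 0) => M /=.
  by rewrite /aaM big1 // => j _; rewrite (a_Om hF) (a0 hF).
have Sfs : Sn (size fs) (cvec ad Om fs) by exact: Sn_cvec.
apply: (hcvg_ext (u := fun M => ad f (aaM C e M (cvec ad Om fs)) +
    (a (onproj ipL M e (A f)) (cvec ad Om fs) +
     a (J (C (onproj ipL M e (J f)))) (cvec ad Om fs)))).
  by move=> M; rewrite -aaM_ad //; exact: Sn_S Sfs.
apply: (hcvgD hipF).
  apply: (hcvg_squeeze (r := fun M => Num.sqrt (hnL f ^+ 2 * (size fs).+1%:R) *
      hn (aaM C e M (cvec ad Om fs) - aa_lim C A fs))) => [M|].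
    have h1 := aaM_low2 C e M Sfs; have h2 := aa_lim_low2 C A fs.
    rewrite -(adB hF f (S_D hF (low2_S h1)) (S_D hF (low2_S h2))).
    have k0 : 0 <= hnL f ^+ 2 * (size fs).+1%:R by rewrite mulr_ge0 ?sqr_ge0.
    rewrite -(@ler_pXn2r _ 2) ?nnegrE ?mulr_ge0 ?hn_ge0 ?sqrtr_ge0 //.
    by rewrite exprMn (sqr_sqrtr k0); apply: low2_ad_bound; apply: low2_B.
  by rewrite -(mulr0 (Num.sqrt (hnL f ^+ 2 * (size fs).+1%:R))); apply: cvgM => //; exact: cvg_cst.
apply: (hcvgD hipF); apply: (a_hcvg Sfs).
  exact: (cons_expansion hipL hilbL.2).
apply: (conj_hcvg hJ); apply: (bounded_op_hcvg hC.1).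
exact: (cons_expansion hipL hilbL.2).
Qed.

Lemma aaM_bound e M c2 n Psi : 0 <= c2 -> orthonormal ipL e ->
  (forall x, \sum_(j < M) normc (ipL (C (e j)) x) ^+ 2 <= c2 * hnL x ^+ 2) ->
  Sn n.+2 Psi ->
  hn (aaM C e M Psi) ^+ 2 <=
    (c2 * n%:R + \sum_(j < M) hnL (C (e j)) ^+ 2) * n.+2%:R * hn Psi ^+ 2.
Proof.
move=> c0 he hb hPsi.
have -> : aaM C e M Psi = \sum_(j < M) a (J (C (e j))) (a (e j) Psi).
  by apply: eq_bigr => j _; rewrite (a_comm hF) //; exact: (Sn_D hF hPsi).
apply: (sum_aa_bound hipL hJ hipF hF (g := fun j => C (e j)) (h := e) hPsi c0 hb).
move=> x; apply: (bessel (u := fun j => J (e j)) (d := M) hipL x).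
by apply: orthonormal_onfam; apply: conj_orthonormal.
Qed.

Lemma sum_ip_le (g : nat -> L) M x :
  \sum_(j < M) normc (ipL (g j) x) ^+ 2 <= (\sum_(j < M) hnL (g j) ^+ 2) * hnL x ^+ 2.
Proof.
rewrite mulr_suml; apply: ler_sum => j _; rewrite -exprMn.
by rewrite lerXn2r ?nnegrE ?mulr_ge0 ?normc_ge0 ?hn_ge0 // (cauchy_schwarz hipL).
Qed.

Definition weak_aa e M z P := forall Psi, S Psi -> ipF Psi z = ipF (aaM C e M Psi) P.

Lemma weak_aa_bound e M c2 z P B : 0 <= c2 -> orthonormal ipL e ->
  (forall x, \sum_(j < M) normc (ipL (C (e j)) x) ^+ 2 <= c2 * hnL x ^+ 2) ->
  weak_aa e M z P ->
  wle (fun n => (c2 * n%:R + \sum_(j < M) hnL (C (e j)) ^+ 2) * n.+2%:R) P B ->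
  hn z ^+ 2 <= B.
Proof.
move=> c0 he hb h hB; apply: (wle_norm hJ hilbF hF).
set b := (fun n : nat => _) in hB.
apply: (wle_raise hJ hilbF hF (s := 2) (b := b)) => [n|m Psi m2 hPsi|m Psi hPsi|n|].
- apply: mulr_ge0 (ler0n _ _); apply: addr_ge0; first by rewrite mulr_ge0.
  by apply: sumr_ge0 => j _; rewrite sqr_ge0.
- rewrite h; last exact: Sn_S hPsi.
  by have := aaM_low2 C e M hPsi; case: m m2 hPsi => [|[|//]] _ _ /= ->; rewrite (ip0l hipF).
- apply: (weak_sector_bound hJ hilbF hF (T := aaM C e M Psi)).
  + exact: (aaM_low2 C e M hPsi).
  + by apply: h; exact: Sn_S hPsi.
  exact: aaM_bound.
- exact: ler01.
by apply: wle_mono hB => n; rewrite mul1r.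
Qed.

(** With [c2 = s] the factor is [(s n + s) (n+2) <= 2 s (n+1)^2], a multiple of the D_1 weight that
    becomes small with [s]. *)
Lemma weak_aa_hs e M z P B : orthonormal ipL e -> weak_aa e M z P -> wle w1 P B ->
  hn z ^+ 2 <= 2 * B * \sum_(j < M) hnL (C (e j)) ^+ 2.
Proof.
move=> he h hB; set s := \sum_(j < M) _.
have s0 : 0 <= s by apply: sumr_ge0 => j _; rewrite sqr_ge0.
rewrite mulrC mulrA; apply: (weak_aa_bound s0 he (sum_ip_le (fun j => C (e j)) M) h).
apply: wle_mono (wle_scale (mulr_ge0 s0 (ler0n R 2)) hB) => n.
rewrite -/s /w1 -[n.+2%:R]natr1 -[n.+1%:R]natr1.
have : (0 : R) <= n%:R by []. set x := n%:R => x0.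
have -> : (s * x + s) * (x + 1 + 1) = s * ((x + 1) * (x + 2)) by ring.
by rewrite -mulrA ler_wpM2l //; nra.
Qed.

Lemma DeltaplusM_weak e M P : (exists B, wle w1 P B) -> weak_aa e M (DeltaplusM C e M P) P.
Proof.
move=> hP Psi SPsi; rewrite /Defs.DeltaplusM (ip_sumr hipF) (ip_suml hipF).
apply: eq_bigr => j _.
have h1 := ad_ext_half hipL hJ hilbF hF (J (e j)) hP.
rewrite (ad_ext_weak hipL hJ hilbF hF (C (e j)) h1 SPsi).
have h2 : exists B, wle w12 P B by case: hP => B /wle_half; exists B.
by rewrite (ad_ext_weak hipL hJ hilbF hF (J (e j)) h2) ?(conjK hJ) //; apply: (a_S hF).
Qed.

Lemma hs_partial_mono (e : nat -> L) m n : (m <= n)%N ->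
  \sum_(j < m) hnL (C (e j)) ^+ 2 <= \sum_(j < n) hnL (C (e j)) ^+ 2.
Proof. exact: (sum_hn2_le (fun j => C (e j))). Qed.

(** A difference of partial sums is a partial sum for the shifted system. The shift preserves
    orthonormality but in general not completeness, which is why the estimates are stated for
    orthonormal systems. *)
Lemma weak_aa_sub e m n z z' P : weak_aa e m z P -> weak_aa e (m + n) z' P ->
  weak_aa (fun j => e (m + j)%N) n (z' - z) P.
Proof.
move=> h h' Psi SPsi; rewrite (ipBr hipF) h // h' // /aaM big_split_ord /=.
by rewrite (ipDl hipF) addrC addKr.
Qed.

Lemma weak_aa_B e M z z' P P' : weak_aa e M z P -> weak_aa e M z' P' ->
  weak_aa e M (z - z') (P - P').
Proof. by move=> h h' Psi SPsi; rewrite !(ipBr hipF) h // h'. Qed.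

Lemma hs_le e n : orthonormal ipL e -> \sum_(j < n) hnL (C (e j)) ^+ 2 <= hs_norm ipL C ^+ 2.
Proof. by move=> he; apply: (hs_norm_ge hilbL hC); apply: orthonormal_onfam. Qed.

Lemma DeltaplusM_cvg e P : orthonormal ipL e -> (exists B, wle w1 P B) ->
  exists z, hcvg (fun M => DeltaplusM C e M P) z.
Proof.
move=> he hP; have [B hB] := hP.
have B0 : 0 <= B by have := hB 0%N; rewrite big_ord0.
apply: hilbF.2; apply: (hcauchy_dominated hipF (A := 2 * B) (B := hs_norm ipL C ^+ 2)
    (s := fun M => \sum_(j < M) hnL (C (e j)) ^+ 2)).
- by rewrite mulr_ge0.
- exact: hs_partial_mono.
- by move=> n; apply: hs_le.
move=> m n mn; rewrite -(subnK mn) [(n - m + m)%N]addnC big_split_ord /=.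
rewrite [X in _ <= _ * X]addrC addKr.
apply: (weak_aa_hs (e := fun j => e (m + j)%N)) hB => [i j|]; first by rewrite he eqn_add2l.
by apply: weak_aa_sub; apply: DeltaplusM_weak.
Qed.

Lemma bessel_opnorm e M x : orthonormal ipL e ->
  \sum_(j < M) normc (ipL (C (e j)) x) ^+ 2 <= opnorm ipL C ^+ 2 * hnL x ^+ 2.
Proof.
move=> he; apply: le_trans (opnorm_adjoint_ge hilbL hC.1 hA x).
under eq_bigr => j _ do rewrite hA.
by apply: (bessel hipL); apply: orthonormal_onfam.
Qed.

Lemma hcvg_hn2_le u z (B : R) : 0 <= B -> hcvg u z -> (forall n, hn (u n) ^+ 2 <= B) ->
  hn z ^+ 2 <= B.
Proof.
move=> B0 hu h; have : hn z <= Num.sqrt B.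
  apply: (hcvg_hn_le hipF hu); exists 0%N => n _.
  by rewrite -(@ler_pXn2r _ 2) ?nnegrE ?hn_ge0 ?sqrtr_ge0 // (sqr_sqrtr B0).
by rewrite -(@ler_pXn2r _ 2) ?nnegrE ?hn_ge0 ?sqrtr_ge0 // (sqr_sqrtr B0).
Qed.

Lemma DeltaplusM_limit_bound e z P : orthonormal ipL e -> (exists B, wle w1 P B) ->
  hcvg (fun M => DeltaplusM C e M P) z ->
  hn z ^+ 2 <=
    opnorm ipL C ^+ 2 *
      hn (mulop ipF ad Om (fun n => Num.sqrt (n%:R * (n%:R + 2))) P) ^+ 2 +
    hs_norm ipL C ^+ 2 * hn (mulop ipF ad Om (fun n => Num.sqrt (n%:R + 2)) P) ^+ 2.
Proof.
move=> he hP hz; have [B hB] := hP.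
set va := fun n : nat => _; set vb := fun n : nat => Num.sqrt _.
have vaE n : va n ^+ 2 = n%:R * (n%:R + 2) by rewrite /va sqr_sqrtr // mulr_ge0 // addr_ge0.
have vbE n : vb n ^+ 2 = n%:R + 2 by rewrite /vb sqr_sqrtr // addr_ge0.
(* A crude majorant of both [n (n+2)] and [n+2]; it serves only to make the two [mulop] vectors
   exist. *)
have h4 : wle (fun n => 4 * w1 n) P (4 * B) by apply: wle_scale.
have wE n : w1 n = (n%:R + 1) ^+ 2 :> R by rewrite /w1 -natr1.
have ha := mulop_ge hJ hilbF hF (w := va) (P := P) (B := 4 * B).
have hb := mulop_ge hJ hilbF hF (w := vb) (P := P) (B := 4 * B).
have {}ha : wle (fun n => va n ^+ 2) P (hn (mulop ipF ad Om va P) ^+ 2).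
  by apply: ha; apply: wle_mono h4 => n; rewrite vaE wE; have : 0 <= n%:R :> R by []; nra.
have {}hb : wle (fun n => vb n ^+ 2) P (hn (mulop ipF ad Om vb P) ^+ 2).
  by apply: hb; apply: wle_mono h4 => n; rewrite vbE wE; have : 0 <= n%:R :> R by []; nra.
apply: (hcvg_hn2_le _ hz) => [|M]; first by apply: addr_ge0; apply: mulr_ge0; exact: sqr_ge0.
apply: (weak_aa_bound (sqr_ge0 (opnorm ipL C)) he (fun x => bessel_opnorm M x he)
  (DeltaplusM_weak e M hP)).
move=> N; apply: le_trans (_ : \sum_(n < N) (opnorm ipL C ^+ 2 * (va n ^+ 2 * hn (comp n P) ^+ 2)
    + hs_norm ipL C ^+ 2 * (vb n ^+ 2 * hn (comp n P) ^+ 2)) <= _).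
  apply: ler_sum => n _; rewrite vaE vbE.
  have := hs_le M he; have := sqr_ge0 (hn (comp n P)).
  move: (hn (comp n P) ^+ 2) (opnorm ipL C ^+ 2) (hs_norm ipL C ^+ 2) => x o h x0 hle.
  have -> : n.+2%:R = n%:R + 2 :> R by rewrite -addn2 natrD.
  have -> : o * (n%:R * (n%:R + 2) * x) + h * ((n%:R + 2) * x) =
      (o * n%:R + h) * (n%:R + 2) * x by ring.
  by rewrite ler_wpM2r // ler_wpM2r ?addr_ge0 // lerD2l.
rewrite big_split /= -!mulr_sumr; apply: lerD.
  by apply: ler_wpM2l; [exact: sqr_ge0|exact: ha].
by apply: ler_wpM2l; [exact: sqr_ge0|exact: hb].
Qed.

End Operator.

Section Transposition.
(** [C'] plays the transpose [J A J] of [C], and [A'] its adjoint [J C J]; [A'E] and [C'E] express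
    this. *)
Variables C A C' A' : L -> L.
Hypothesis hC : hilbert_schmidt ipL C.
Hypothesis hA : forall x y, ipL (C x) y = ipL x (A y).
Hypothesis hC' : hilbert_schmidt ipL C'.
Hypothesis hA' : forall x y, ipL (C' x) y = ipL x (A' y).
Hypothesis A'E : forall f, A' f = J (C (J f)).
Hypothesis C'E : forall f, J (C' (J f)) = A f.

(** [X] is chosen before the system and shared by [C] and [C'], so that this one statement yields
    both independence of the system and invariance under transposition. *)
Lemma aaM_limit Psi : S Psi -> exists X, forall e, cons_ ipL e ->
  hcvg (fun M => aaM C e M Psi) X /\ hcvg (fun M => aaM C' e M Psi) X.
Proof.
suff h : S Psi -> S Psi /\ exists X, forall e, cons_ ipL e ->
  hcvg (fun M => aaM C e M Psi) X /\ hcvg (fun M => aaM C' e M Psi) X by move=> /h [].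
elim/(@hspan_ind _ _ (all_cvecs ad Om)) => [|c _ x [fs _ <-] [Sx [X hX]]].
  split; first exact: hspan0.
  exists 0 => e _; split; apply: hcvg_ext (hcvg_cst hipF 0) => M;
    by rewrite /aaM big1 // => j _; rewrite !(a0 hF).
have Sfs : S (cvec ad Om fs) by apply: hspan_sub; exists fs.
split; first exact: hspan_lin.
exists (c *: aa_lim C A fs + X) => e he; have [h1 h2] := hX e he; split.
  apply: hcvg_ext (hcvgD hipF (hcvgZ hipF c (aaM_cvec hC hA fs he)) h1) => M.
  by rewrite aaM_lin.
apply: hcvg_ext (hcvgD hipF (hcvgZ hipF c (_ : hcvg _ (aa_lim C A fs))) h2) => [M|].
  by rewrite aaM_lin.
by rewrite -(aa_lim_transp fs A'E C'E); apply: aaM_cvec.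
Qed.

Lemma weak_aa_limit (K : L -> L) e X z Psi P : S Psi -> (exists B, wle w1 P B) ->
  hcvg (fun M => DeltaplusM K e M P) z -> hcvg (fun M => aaM K e M Psi) X ->
  ipF Psi z = ipF X P.
Proof.
move=> SPsi hP hz hX.
apply: (hcvg_ip_eq hipF hipF (hcvg_cst hipF Psi) hz hX (hcvg_cst hipF P)) => M.
exact: DeltaplusM_weak.
Qed.

Lemma DeltaplusM_limit P : (exists B, wle w1 P B) -> exists z, forall e, cons_ ipL e ->
  hcvg (fun M => DeltaplusM C e M P) z /\ hcvg (fun M => DeltaplusM C' e M P) z.
Proof.
move=> hP; have [_ [e0 [_ [he0 _]]]] := hC.
have [z hz] := DeltaplusM_cvg hC he0.1 hP.
exists z => e he.
have [z1 hz1] := DeltaplusM_cvg hC he.1 hP.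
have [z2 hz2] := DeltaplusM_cvg hC' he.1 hP.
(* Any limit whose pairings with [S] are given by the common [X] must be [z]. *)
have E z' : (forall Psi X, S Psi ->
    (forall e, cons_ ipL e -> hcvg (fun M => aaM C e M Psi) X /\ hcvg (fun M => aaM C' e M Psi) X) ->
    ipF Psi z' = ipF X P) -> z' = z.
  move=> h; apply: (weak_unique hilbF hF) => Psi SPsi; have [X hX] := aaM_limit SPsi.
  rewrite (h _ _ SPsi hX); have [h1 _] := hX _ he0.
  by rewrite (weak_aa_limit SPsi hP hz h1).
split.
  by rewrite -(E z1) // => Psi X SPsi /(_ e he) [h1 _]; apply: (weak_aa_limit SPsi hP hz1 h1).
by rewrite -(E z2) // => Psi X SPsi /(_ e he) [_ h2]; apply: (weak_aa_limit SPsi hP hz2 h2).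
Qed.

Lemma Deltaplus_cvg e P : cons_ ipL e -> (exists B, wle w1 P B) ->
  hcvg (fun M => DeltaplusM C e M P) (Deltaplus ipL J ipF ad Om C P).
Proof.
move=> he hP; have [z hz] := DeltaplusM_limit hP.
apply: (epsilon_spec (inhabits 0) (fun z => forall e, cons_ ipL e ->
  hcvg (fun M => DeltaplusM C e M P) z)) he.
by exists z => e' /hz [].
Qed.

Lemma Deltaplus_transp P : (exists B, wle w1 P B) ->
  Deltaplus ipL J ipF ad Om C' P = Deltaplus ipL J ipF ad Om C P.
Proof.
move=> hP; have [_ [e0 [_ [he0 _]]]] := hC; have [z hz] := DeltaplusM_limit hP.
have h : hcvg (fun M => DeltaplusM C' e0 M P) (Deltaplus ipL J ipF ad Om C' P).
  apply: (epsilon_spec (inhabits 0) (fun z => forall e, cons_ ipL e ->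
    hcvg (fun M => DeltaplusM C' e M P) z)) he0.
  by exists z => e' /hz [].
by rewrite (hcvg_unique hipF h (hz _ he0).2) (hcvg_unique hipF (Deltaplus_cvg he0 hP) (hz _ he0).1).
Qed.

(** * The symmetric case: Delta and its adjoint relation *)

Hypothesis symC : C' = C.
Local Notation Dp := (Deltaplus ipL J ipF ad Om C).

Lemma adj_conj x : J (A x) = C (J x).
Proof. by rewrite -C'E (conjK hJ) symC. Qed.

Lemma DeltaplusM_S e M Psi : S Psi -> DeltaplusM C e M Psi =
  \sum_(j < M) ad (C (e j)) (ad (J (e j)) Psi).
Proof.
move=> SPsi; apply: eq_bigr => j _.
by rewrite !(ad_ext_S hipL hJ hilbF hF) //; apply: (ad_S hF).
Qed.

Lemma DeltaplusM_Sn e M n Psi : Sn n Psi -> Sn n.+2 (DeltaplusM C e M Psi).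
Proof.
move=> hPsi; rewrite (DeltaplusM_S _ _ (Sn_S hPsi)).
apply: (hspan_sum (f := fun j => ad (C (e j)) (ad (J (e j)) Psi))) => j _.
by do 2!apply: (ad_Sn hF).
Qed.

Lemma DeltaM_weak e M P Psi : (exists B, wle w1 P B) -> S Psi ->
  ipF Psi (DeltaM A e M P) = ipF (DeltaplusM C (fun j => J (e j)) M Psi) P.
Proof.
move=> hP SPsi; rewrite (DeltaplusM_S _ _ SPsi) (ip_sumr hipF) (ip_suml hipF).
apply: eq_bigr => j _.
have h1 := a_ext_half hipL hJ hilbF hF (J (e j)) hP.
rewrite (a_ext_weak hipL hJ hilbF hF (A (e j)) h1 SPsi) adj_conj.
have h2 : exists B, wle w12 P B by case: hP => B /wle_half; exists B.
rewrite (a_ext_weak hipL hJ hilbF hF (J (e j)) h2); last exact: (ad_S hF).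
(* The two creators arrive in the opposite order and commute on [D]. *)
congr (ipF _ P); case: hF => _ _ h _ _.
by case: (h (J (J (e j))) (C (J (e j))) _ (S_D hF SPsi)).
Qed.

(* By duality with [aaM_bound]. *)
Lemma DeltaplusM_Sn_bound e M n Psi : orthonormal ipL e -> Sn n Psi ->
  hn (DeltaplusM C e M Psi) ^+ 2 <=
    (\sum_(j < M) hnL (C (e j)) ^+ 2) * (n.+1%:R * n.+2%:R) * hn Psi ^+ 2.
Proof.
move=> he hPsi; set T := DeltaplusM C e M Psi; set s := \sum_(j < M) _.
have s0 : 0 <= s by apply: sumr_ge0 => j _; rewrite sqr_ge0.
have hT : Sn n.+2 T by apply: DeltaplusM_Sn.
have hw : weak_aa C e M T Psi.
  by apply: DeltaplusM_weak; apply: (S_wle hJ hilbF hF w1_ge0); exact: Sn_S hPsi.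
have hU := aaM_bound s0 he (sum_ip_le (fun j => C (e j)) M) hT.
set U := aaM C e M T in hU.
have TU : hn T ^+ 2 <= hn U * hn Psi.
  apply: le_trans (cauchy_schwarz hipF _ _).
  by rewrite -hw ?(Sn_S hT) // -?(hn2E hipF) ?normc_real ?ler_norm //; exact: Sn_S hT.
have [T0|T0] := eqVneq (hn T) 0.
  rewrite T0 expr2 mulr0; apply: mulr_ge0 (sqr_ge0 _); apply: mulr_ge0 s0 _.
  by rewrite mulr_ge0 ?ler0n.
have hT0 : 0 < hn T ^+ 2 by apply: exprn_gt0; rewrite lt_def T0 hn_ge0.
rewrite -(ler_pM2r hT0) -expr2.
apply: le_trans (_ : (hn U * hn Psi) ^+ 2 <= _).
  by rewrite lerXn2r ?nnegrE ?mulr_ge0 ?hn_ge0 ?sqr_ge0.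
rewrite exprMn; apply: le_trans (ler_wpM2r (sqr_ge0 _) hU) _.
by rewrite le_eqVlt; apply/orP; left; apply/eqP; rewrite -/s -[n.+1%:R]natr1; ring.
Qed.

(** A tail of Delta_M is dual to a tail of Delta^+_M for the conjugated system, so the sector bound
    of the latter controls it through [wle_lower]. *)
Lemma DeltaM_cvg e P : orthonormal ipL e -> (exists B, wle w1 P B) ->
  exists z, hcvg (fun M => DeltaM A e M P) z.
Proof.
move=> he hP; have [B hB] := hP.
have B0 : 0 <= B by have := hB 0%N; rewrite big_ord0.
have heJ := conj_orthonormal hJ he.
apply: hilbF.2; apply: (hcauchy_dominated hipF (A := B) (B := hs_norm ipL C ^+ 2)
    (s := fun M => \sum_(j < M) hnL (C (J (e j))) ^+ 2)) => //.
- exact: (hs_partial_mono C (fun j => J (e j))).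
- by move=> n; apply: (hs_le hC n heJ).
move=> m n mn; rewrite -(subnK mn) [(n - m + m)%N]addnC big_split_ord /=.
rewrite [X in _ <= _ * X]addrC addKr; move: (n - m)%N => k.
set s := \sum_(i < k) _.
have s0 : 0 <= s by apply: sumr_ge0 => j _; rewrite sqr_ge0.
pose e' j := J (e (m + j)%N).
have he' : orthonormal ipL e' by move=> i j; rewrite heJ eqn_add2l.
rewrite mulrC; apply: (wle_norm hJ hilbF hF).
apply: (wle_lower hJ hilbF hF (s := 2) (b := fun n => s * (n.+1%:R * n.+2%:R))
   (v := fun n => s * w1 n)) (wle_scale s0 hB).
- by move=> i; rewrite mulr_ge0 ?mulr_ge0.
- move=> i Psi hPsi.
  apply: (weak_sector_bound hJ hilbF hF (T := DeltaplusM C e' k Psi)).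
  + exact: DeltaplusM_Sn.
  + rewrite (ipBr hipF) !DeltaM_weak ?(Sn_S hPsi) //; try exact: Sn_S hPsi.
    by rewrite /Defs.DeltaplusM big_split_ord /= (ipDl hipF) addrC addKr.
  exact: DeltaplusM_Sn_bound.
- by move=> _; exact: ler01.
- by move=> i; rewrite mulr_ge0 // w1_ge0.
(* [(i+1) (i+2) <= (i+3)^2], the D_1 weight two sectors higher. *)
move=> i; rewrite mul1r ler_wpM2l // /w1 expr2; apply: ler_pM => //;
  by rewrite ler_nat // !add2n ltnW.
Qed.

Lemma DeltaM_limit e z P Psi : cons_ ipL e -> (exists B, wle w1 P B) ->
  hcvg (fun M => DeltaM A e M P) z -> S Psi -> ipF Psi z = ipF (Dp Psi) P.
Proof.
move=> he hP hz SPsi.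
have hPsi : exists B, wle w1 Psi B by apply: (S_wle hJ hilbF hF w1_ge0).
have h := Deltaplus_cvg (conj_cons hilbL hJ he) hPsi.
apply: (hcvg_ip_eq hipF hipF (hcvg_cst hipF Psi) hz h (hcvg_cst hipF P)) => M.
exact: DeltaM_weak.
Qed.

Lemma Delta_cvg e P : cons_ ipL e -> (exists B, wle w1 P B) ->
  hcvg (fun M => DeltaM A e M P) (Delta ipL J ipF a ad Om A P).
Proof.
move=> he hP; apply: (epsilon_spec (inhabits 0) (fun z => forall e, cons_ ipL e ->
  hcvg (fun M => DeltaM A e M P) z)) he.
have [_ [e0 [_ [he0 _]]]] := hC; have [z hz] := DeltaM_cvg he0.1 hP.
exists z => e' he'; have [z' hz'] := DeltaM_cvg he'.1 hP.
suff -> : z = z' by [].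
apply: (weak_unique hilbF hF) => Psi SPsi.
by rewrite (DeltaM_limit he0 hP hz SPsi) (DeltaM_limit he' hP hz' SPsi).
Qed.

(** Continuity of Delta^+ in the D_1 norm. Linearity enters at the level of the weak relation for
    partial sums, so differences of values are estimated directly. *)
Lemma Deltaplus_B e P Q B : cons_ ipL e -> (exists B, wle w1 P B) -> (exists B, wle w1 Q B) ->
  wle w1 (P - Q) B -> hn (Dp P - Dp Q) ^+ 2 <= 2 * B * hs_norm ipL C ^+ 2.
Proof.
move=> he hP hQ hB; have B0 : 0 <= B by have := hB 0%N; rewrite big_ord0.
apply: (hcvg_hn2_le _ (hcvgB hipF (Deltaplus_cvg he hP) (Deltaplus_cvg he hQ))) => [|M].
  by apply: mulr_ge0 (sqr_ge0 _); rewrite mulr_ge0.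
apply: le_trans (weak_aa_hs (e := e) (M := M) he.1 _ hB) _.
  by apply: weak_aa_B; apply: DeltaplusM_weak.
by rewrite ler_wpM2l ?mulr_ge0 // (hs_le hC M he.1).
Qed.

(** [DeltaM_limit] gives the relation for [Q] in [S]. The approximants of a general [Q] converge in
    the D_1 norm, in which Delta^+ is continuous. *)
Lemma Deltaplus_adjoint P Q : (exists B, wle w1 P B) -> (exists B, wle w1 Q B) ->
  ipF P (Dp Q) = ipF (Delta ipL J ipF a ad Om A P) Q.
Proof.
move=> hP hQ; have [_ [e [_ [he _]]]] := hC.
have [B hB] := hQ.
have [u [Su hu]] := wle_approx_seq hJ hilbF hF w1_ge0 hB.
have huw k : exists B, wle w1 (u k) B by apply: (S_wle hJ hilbF hF w1_ge0).
have uQ : hcvg u Q.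
  apply: (wle12_hcvg hJ hilbF hF) => eps /inv_succ_small [K hK]; exists K => k /hK /ltW kK.
  by apply: wle_half; apply: wle_le kK (hu k).
have DuQ : hcvg (fun k => Dp (u k)) (Dp Q).
  apply/hcvgP => eps eps0.
  have s0 : 0 <= 2 * hs_norm ipL C ^+ 2 by apply: mulr_ge0 (sqr_ge0 _).
  have e2 : 0 < eps ^+ 2 / (2 * hs_norm ipL C ^+ 2 + 1).
    by apply: divr_gt0; [exact: exprn_gt0|exact: ltr_wpDl].
  have [K hK] := inv_succ_small e2; exists K => k /hK.
  rewrite ltr_pdivlMr ?ltr_wpDl // => hk; apply: hn_lt_sqr => //.
  apply: le_lt_trans (Deltaplus_B he (huw k) hQ (hu k)) _.
  apply: le_lt_trans hk; rewrite [2 * _]mulrC -mulrA ler_wpM2l ?invr_ge0 //.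
  by rewrite lerDl.
rewrite (ipC hipF) [RHS](ipC hipF); congr (_^*).
apply: (hcvg_ip_eq hipF hipF DuQ (hcvg_cst hipF P) uQ (hcvg_cst hipF _)) => k.
by rewrite (DeltaM_limit he hP (Delta_cvg he hP) (Su k)).
Qed.

End Transposition.
End Quadratic.

Theorem theorem5p11 (R : realType)
  (L : lmodType R[i]) (ipL : L -> L -> R[i]) (J : L -> L)
  (F : lmodType R[i]) (ipF : F -> F -> R[i])
  (a ad : L -> F -> F) (D : set F) (Om : F)
  (C : L -> L) :
  hilbert ipL -> separable ipL -> infinite_dim ipL -> conjugation ipL J ->
  hilbert ipF -> fock_rep ipL J ipF a ad D Om ->
  hilbert_schmidt ipL C ->
  let D1 := Dalpha ipF ad Om 1 in
  [/\ (* strong convergence on D_1, to a limit independent of the system *)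
      (forall e, cons_ ipL e -> forall P, D1 P ->
         hcvg ipF (fun M => DeltaplusM J ipF ad Om C e M P)
                  (Deltaplus ipL J ipF ad Om C P)),
      (* the bound *)
      (forall P, D1 P ->
         hnorm ipF (Deltaplus ipL J ipF ad Om C P) ^+ 2 <=
           opnorm ipL C ^+ 2 *
             hnorm ipF (mulop ipF ad Om
                          (fun n => Num.sqrt (n%:R * (n%:R + 2))) P) ^+ 2
         + hs_norm ipL C ^+ 2 *
             hnorm ipF (mulop ipF ad Om (fun n => Num.sqrt (n%:R + 2)) P) ^+ 2),
      (* Delta^+(C^T) = Delta^+(C) *)
      (forall P, D1 P ->
         Deltaplus ipL J ipF ad Om (transp ipL J C) P =
         Deltaplus ipL J ipF ad Om C P) &
      (* if C^T = C then Delta^+(C) is the adjoint of Delta(adjoint C) on D_1 *)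
      (transp ipL J C = C ->
         (forall e, cons_ ipL e -> forall P, D1 P ->
            hcvg ipF (fun M => DeltaM J ipF a ad Om (adjoint ipL C) e M P)
                     (Delta ipL J ipF a ad Om (adjoint ipL C) P)) /\
         (forall P Q, D1 P -> D1 Q ->
            ipF P (Deltaplus ipL J ipF ad Om C Q) =
            ipF (Delta ipL J ipF a ad Om (adjoint ipL C) P) Q))].
Proof.
move=> hilbL _ _ hJ hilbF hF hC D1.
have [A hA] := hs_adjoint_ex hilbL hC.
have adjE : adjoint ipL C = A by exact: (adjointE hilbL hA).
have trE : transp ipL J C = cbar J A by exact: (transpE hilbL hJ hA).
have D1P P : D1 P -> exists B, wle (ipF := ipF) (ad := ad) (Om := Om) w1 P B by move/Dalpha1P.
(* From here the transposition results are instantiated with [C' = cbar J A] and [A' = cbar J C]. *)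
have hC' := transp_hs hilbL hJ hC hA.
have hA' : forall x y, ipL (cbar J A x) y = ipL x (cbar J C y).
  apply: (cbar_adjoint hilbL hJ) => x y.
  by rewrite (ipC hilbL.1) -hA -(ipC hilbL.1).
have A'E : forall f, cbar J C f = J (C (J f)) by [].
have C'E : forall f, J (cbar J A (J f)) = A f by move=> f; rewrite /cbar !(conjK hJ).
have cvg_Dp := Deltaplus_cvg hilbL hJ hilbF hF hC hA hC' hA' A'E C'E.
split.
- by move=> e he P /D1P hP; apply: cvg_Dp.
- move=> P /D1P hP; have [_ [e [_ [he _]]]] := hC.
  exact: (DeltaplusM_limit_bound hilbL hJ hilbF hF hC hA he.1 hP (cvg_Dp e P he hP)).
- move=> P /D1P hP; rewrite trE.
  exact: (Deltaplus_transp hilbL hJ hilbF hF hC hA hC' hA' A'E C'E hP).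
rewrite trE adjE => symC; split.
  move=> e he P /D1P hP.
  exact: (Delta_cvg hilbL hJ hilbF hF hC hA hC' hA' A'E C'E symC he hP).
move=> P Q /D1P hP /D1P hQ.
exact: (Deltaplus_adjoint hilbL hJ hilbF hF hC hA hC' hA' A'E C'E symC hP hQ).
Qed.
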